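(* Let $C$ be a connectivity on $\Sigma=\{0,\dots,N-1\}$, let $\Theta$ be the associated mesh transformation, let $M_C\in\mathbb{R}^{2N}$ be a triangle mesh with connectivity $C$ that is a fixed point of $\Theta$, i.e. $\Theta(M_C)=M_C$, and let $\Lambda:=\operatorname{Sim}(\mathbb{R}^2).M_C$ be its group orbit. Suppose that every eigenvalue of the Jacobian matrix $D\Theta$ (at $M_C$) other than the four eigenvalues equal to $1$ belonging to the directions tangent to $\Lambda$ (eigenvalues counted with algebraic multiplicity) has absolute value strictly smaller than $1$. Then $\Lambda$ is an attractor, and for any triangle mesh $M$ with connectivity $C$ sufficiently close to $\Lambda$, $\Theta^n(M)$ converges uniformly at exponential rate to one point in $\Lambda$ as $n\to\infty$.
   Context: Here $\operatorname{Sim}(\mathbb{R}^2)$ denotes the four-dimensional group of maps $g(y)=\lambda(Ay+b)$ of $\mathbb{R}^2$ with $\lambda>0$, $A\in SO(2)$, $b\in\mathbb{R}^2$; it acts on $(\mathbb{R}^2)^N$ by $g.(x_0,\dots,x_{N-1})=(g(x_0),\dots,g(x_{N-1}))$. The transformation $\Theta$ is equivariant under this action, so every point of $\Lambda$ is a fixed point, $\Lambda$ is a four-dimensional submanifold, and $D\Theta$ restricted to the tangent space of $\Lambda$ has four eigenvalues equal to $1$. Triangle meshes: a connectivity is a finite set $C$ of triples $\Delta_i=(i_0,i_1,i_2)\in\Sigma^3$, $i=0,\dots,n-1$, such that any two triples can be joined by a finite sequence of triples in $C$ in which consecutive ones have exactly two symbols in common. A triangle mesh with connectivity $C$ is an injective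 map $\Sigma\to\mathbb{R}^2$, $k\mapsto x_k$, identified with $x=(x_0,\dots,x_{N-1})\in(\mathbb{R}^2)^N=\mathbb{R}^{2N}$, such that the triangles $(x_{i_0},x_{i_1},x_{i_2})$, with vertices listed counterclockwise, are non-degenerate and have pairwise disjoint interiors. Triangle transformation: for a triangle $(y_0,y_1,y_2)$ with centroid $c=\frac13(y_0+y_1+y_2)$ and $r_j=\|y_{j-1}-c\|/\|y_j-c\|$ (indices modulo $3$), set $$\theta_j(y_0,y_1,y_2)=\tfrac23 r_j(y_j-c)-\tfrac13 r_{j+1}(y_{j+1}-c)-\tfrac13 r_{j-1}(y_{j-1}-c)+c,\quad j\in\mathbb{Z}_3.$$ Mesh transformation: for $k\in\Sigma$ let $\Sigma_k$ be the set of indices $m$ of triples $\Delta_m=(m_0,m_1,m_2)\in C$ containing the symbol $k$, and let $j(m)\in\{0,1,2\}$ be the position of $k$ in $\Delta_m$. Then $\Theta(x)=(\Theta_0(x),\dots,\Theta_{N-1}(x))$ with $$\Theta_k(x)=\frac1{|\Sigma_k|}\sum_{m\in\Sigma_k}\theta_{j(m)}(x_{m_0},x_{m_1},x_{m_2}).$$ *)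

(* Defs.v *)
From HB Require Import structures.
From mathcomp Require Import all_boot all_order all_algebra.
From mathcomp Require Import complex.
From mathcomp Require Import all_classical all_reals all_analysis.

Set Implicit Arguments.
Unset Strict Implicit.
Unset Printing Implicit Defensive.

Import Order.TTheory GRing.Theory Num.Theory numFieldNormedType.Exports.

Local Open Scope classical_set_scope.
Local Open Scope ring_scope.

Section Connectivity.
Variable N : nat.

Definition triple := {ffun 'I_3 -> 'I_N}.

Definition symbols (D : triple) : {set 'I_N} := [set D j | j : 'I_3]%SET.

Definition share_two : rel triple :=
  fun D D' => #|symbols D :&: symbols D'|%SET == 2%N.

Definition connectivity (C : {set triple}) : Prop :=
  forall D D' : triple, D \in C -> D' \in C ->
    exists s : seq triple,
      [/\ {subset s <= C}, path share_two D s & last D s = D'].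

Definition incident (C : {set triple}) (k : 'I_N) : {set triple} :=
  [set D in C | k \in symbols D]%SET.

(* Without this, the average defining [mesh_transform] is over an empty set. *)
Definition every_symbol_used (C : {set triple}) : Prop :=
  forall k : 'I_N, incident C k != finset.set0.

(* The position is unique when the symbols of D are distinct, which is forced
   by the existence of a triangle mesh; the default value is irrelevant. *)
Definition position (k : 'I_N) (D : triple) : 'I_3 :=
  odflt ord0 [pick j | D j == k].

End Connectivity.

Section Plane.
Variable R : realType.

(* The library norm on ['rV[R]_2] is the sup norm, hence this definition. *)
Definition enorm (v : 'rV[R]_2) : R := Num.sqrt (\sum_i v ord0 i ^+ 2).

Definition signed_area2 (y : 'I_3 -> 'rV[R]_2) : R :=
  let u := y 1 - y 0 in let v := y 2%:R - y 0 in
  u ord0 0 * v ord0 1 - u ord0 1 * v ord0 0.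

(* Strict positivity expresses both non-degeneracy and orientation. *)
Definition ccw_nondegenerate (y : 'I_3 -> 'rV[R]_2) : Prop :=
  0 < signed_area2 y.

Definition triangle (y : 'I_3 -> 'rV[R]_2) : set 'rV[R]_2 :=
  [set p | exists t : 'I_3 -> R,
     [/\ forall j, 0 <= t j, \sum_j t j = 1 & p = \sum_j t j *: y j]].

Definition centroid (y : 'I_3 -> 'rV[R]_2) : 'rV[R]_2 :=
  3^-1 *: (y 0 + y 1 + y 2%:R).

(* Indices are added in the group ['I_3], i.e. modulo 3. *)
Definition ratio (y : 'I_3 -> 'rV[R]_2) (j : 'I_3) : R :=
  enorm (y (j - 1) - centroid y) / enorm (y j - centroid y).

Definition triangle_transform (y : 'I_3 -> 'rV[R]_2) (j : 'I_3) : 'rV[R]_2 :=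
  let c := centroid y in
  (2 / 3 * ratio y j) *: (y j - c)
  - (1 / 3 * ratio y (j + 1)) *: (y (j + 1) - c)
  - (1 / 3 * ratio y (j - 1)) *: (y (j - 1) - c) + c.

End Plane.

(* A point x of (R^2)^N is an N x 2 matrix whose k-th row is x_k. *)
Section Mesh.
Variables (R : realType) (N : nat).
Implicit Types (C : {set triple N}) (x : 'M[R]_(N, 2)).

Definition vertices x (D : triple N) : 'I_3 -> 'rV[R]_2 :=
  fun j => row (D j) x.

Definition triangle_mesh C x : Prop :=
  [/\ injective (fun k => row k x),
      forall D, D \in C -> ccw_nondegenerate (vertices x D)
    & forall D D', D \in C -> D' \in C -> D != D' ->
        (triangle (vertices x D))° `&` (triangle (vertices x D'))° = set0].

Definition mesh_transform C x : 'M[R]_(N, 2) :=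
  \matrix_(k < N) ((#|incident C k|%:R)^-1 *:
    \sum_(D in incident C k)
      triangle_transform (vertices x D) (position k D)).

(* Points are row vectors, so A y reads [y *m A^T]. *)
Definition similarity (lam : R) (A : 'M[R]_2) (b y : 'rV[R]_2) : 'rV[R]_2 :=
  lam *: (y *m A^T + b).

Definition sim_orbit x : set 'M[R]_(N, 2) :=
  [set z | exists (lam : R) (A : 'M[R]_2) (b : 'rV[R]_2),
     [/\ 0 < lam, A *m A^T = 1%:M, \det A = 1
       & z = \matrix_(k < N) similarity lam A b (row k x)]].

(* The analogue of [jacobian] on matrices, flattened by [mxvec] to R^(N * 2);
   like [jacobian] it acts on row vectors. *)
Definition mesh_jacobian (F : 'M[R]_(N, 2) -> 'M[R]_(N, 2)) x :
  'M[R]_(N * 2) := lin_mx ('d F x).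

End Mesh.

(* The complex eigenvalues of A, repeated according to their algebraic
   multiplicity. *)
Definition eigenvalues (R : realType) (n : nat) (A : 'M[R]_n) : seq R[i] :=
  sval (closed_field_poly_normal (char_poly (map_mx (real_complex R) A))).

(* Not required to be compact: the Sim(R^2)-orbits are not. *)
Definition attractor (R : realType) (V : normedModType R)
    (f : V -> V) (A : set V) : Prop :=
  f @` A = A /\
  exists U : set V,
    [/\ open U, A `<=` U, f @` U `<=` U,
        \bigcap_n (iter n f @` U) = A
      & forall x, U x -> forall e : R, 0 < e ->
          \forall n \near \oo, exists2 p, A p & `|iter n f x - p| < e].

(* Main.v *)
(* Identify the plane with the complex numbers.  The orbit of p consists of the
   configurations a p + b with a, b complex and a <> 0, so it is open in a linear
   subspace T of real dimension 4, and it is pointwise fixed by the equivariant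
   map F.  Fix two indices k, l with p_k <> p_l: a configuration x with
   x_k <> x_l is carried by a unique similarity to one agreeing with p at k and
   l, namely p + slice x, and slice x is invariant under similarities.  Hence F
   induces a map on the slice, whose derivative is K = (projection along T) o DF.
   As T is fixed by DF, X^4 char(DF) = (X - 1)^4 char(K); so K has spectral
   radius < 1, and the induced map contracts an adapted norm of the slice.  This
   estimate is uniform along the orbit by equivariance.  Since F moves x by at
   most a constant times |x_k - x_l| times the size of slice x, the iterates
   converge geometrically, and the limit has slice 0, i.e. lies on the orbit. *)

Require Import Defs.
From HB Require Import structures.
From mathcomp Require Import all_boot all_order all_algebra.
From mathcomp Require Import complex.
From mathcomp Require Import all_classical all_reals all_analysis.
From mathcomp Require Import ring lra.
Set Implicit Arguments.
Unset Strict Implicit.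
Unset Printing Implicit Defensive.
Import Order.TTheory GRing.Theory Num.Theory numFieldNormedType.Exports.
Local Open Scope classical_set_scope.
Local Open Scope ring_scope.

(** * Spectral radius and powers of a matrix *)

Section Spectrum.

(* Both factorizations of the determinant of the block matrix
   [[X - A, - A B'], [B, 1]]: eliminate with its lower right corner, or use
   [B (X - A) = (X - 1) B] to clear its lower left corner. *)
Lemma char_poly_deflate (R : comNzRingType) (m n : nat) (A : 'M[R]_n)
    (B : 'M[R]_(m, n)) (B' : 'M[R]_(n, m)) :
  B *m B' = 1%:M -> B *m A = B ->
  'X^m * char_poly A = ('X - 1) ^+ m * char_poly (A - A *m B' *m B).
Proof.
move=> BB' BA.
pose a := map_mx polyC A; pose b := map_mx polyC B; pose b' := map_mx polyC B'.
have bb' : b *m b' = 1%:M by rewrite -map_mxM BB' map_mx1.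
have ba : b *m a = b by rewrite -map_mxM BA.
pose M := block_mx ('X%:M - a) (- (a *m b')) b 1%:M.
have detM : \det M = char_poly (A - A *m B' *m B).
  have := det_mulmx (block_mx 1%:M (a *m b') 0 1%:M) M.
  rewrite mulmx_block det_ublock !det1 !mul1r => <-.
  rewrite !mul1mx !mul0mx !add0r mulmx1 addNr det_lblock det1 mulr1.
  rewrite /char_poly /char_poly_mx map_mxB !map_mxM /= -/a -/b -/b'.
  by congr (\det _); rewrite opprB addrA addrAC.
have := det_mulmx (block_mx 1%:M 0 (- b) ('X - 1)%:M) M.
rewrite mulmx_block det_lblock det1 mul1r det_scalar detM => <-.
rewrite !mul1mx !mul0mx !addr0 mulmx1.
have -> : - b *m ('X%:M - a) + ('X - 1)%:M *m b = 0.
  rewrite mulmxBr !mulNmx opprK ba mul_mx_scalar mul_scalar_mx scalerBl scale1r.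
  by rewrite addrC addrACA subrr addNr addr0.
have -> : - b *m - (a *m b') + ('X - 1)%:M = 'X%:M.
  by rewrite mulNmx mulmxN opprK mulmxA ba bb' raddfB /= addrC subrK.
by rewrite det_ublock det_scalar mulrC.
Qed.

(* Since [u_(k+1) - z u_k] decays geometrically when [u_k = M ^ k Q] and
   [(M - z) Q] is in the induction hypothesis, the factors of the annihilating
   polynomial can be treated one at a time. *)
Lemma geometric_decay (C : numFieldType) (n p : nat) (M : 'M[C]_n.+1)
    (s : seq C) (Q : 'M[C]_(n.+1, p)) :
  all (fun z => `|z| < 1) s ->
  horner_mx M (\prod_(z <- s) ('X - z%:P)) *m Q = 0 ->
  exists c q : C, [/\ 0 <= c, 0 < q < 1 &
    forall k i j, `|(M ^+ k *m Q) i j| <= c * q ^+ k].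
Proof.
elim: s Q => [|z s IH] Q.
  rewrite big_nil rmorph1 mul1mx => _ ->; exists 0, 2^-1; split=> //.
    by rewrite invr_gt0 ltr0n invf_lt1 ?ltr1n ?ltr0n.
  by move=> k i j; rewrite mulmx0 mxE normr0 mul0r.
rewrite big_cons /= mulrC rmorphM /= => /andP[z1 sall].
rewrite -[X in _ * X]/(horner_mx M ('X - z%:P)) -mulmxE -mulmxA.
move=> /(IH _ sall)[c [q [c0 /andP[q0 q1] hc]]].
(* The new rate must be below 1, at least [q], and strictly above [|z|]. The number q + |z| (1 - q)
   = 1 - (1 - q)(1 - |z|) satisfies all three. *)
have zq : `|z| < q + `|z| * (1 - q).
  have -> : q + `|z| * (1 - q) = `|z| + q * (1 - `|z|) by ring.
  by rewrite ltrDl mulr_gt0 ?subr_gt0.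
set r := q + `|z| * (1 - q) in zq.
have qr : q <= r by rewrite lerDl mulr_ge0 ?subr_ge0 // ltW.
have r0 : 0 < r by exact: lt_le_trans qr.
have r1 : r < 1.
  have -> : r = 1 - (1 - q) * (1 - `|z|) by rewrite /r; ring.
  by rewrite ltrBlDr ltrDl mulr_gt0 ?subr_gt0.
clearbody r.
have cr0 : 0 <= c / (r - `|z|) by rewrite divr_ge0 // subr_ge0 ltW.
(* The first summand settles k = 0. The second gives (r - |z|) d >= c, which closes the recursion
   |u_(k+1)| <= |z| |u_k| + c q^k under the bound d r^k. *)
pose d := \sum_i \sum_j `|Q i j| + c / (r - `|z|).
have d0 : 0 <= d.
  by rewrite addr_ge0 ?sumr_ge0 // => i _; exact: sumr_ge0.
exists d, r; split=> //; first by rewrite r0.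
elim=> [|k IHk] i j.
  rewrite mul1mx expr0 mulr1 /d (bigD1 i) //= (bigD1 j) //= -!addrA lerDl.
  apply: addr_ge0; first exact: sumr_ge0.
  apply: addr_ge0; last exact: cr0.
  by apply: sumr_ge0 => l _; exact: sumr_ge0.
have -> : M ^+ k.+1 *m Q =
    z *: (M ^+ k *m Q) + M ^+ k *m (horner_mx M ('X - z%:P) *m Q).
  rewrite rmorphB /= horner_mx_X horner_mx_C mulmxBl mulmxBr mul_scalar_mx.
  by rewrite -scalemxAr addrC subrK exprSr -mulmxE mulmxA.
rewrite mxE [X in `|X + _|]mxE (le_trans (ler_normD _ _)) //.
rewrite normrM (le_trans (lerD (ler_wpM2l _ (IHk i j)) (hc k i j))) //.
have : c * q ^+ k <= c * r ^+ k.
  by rewrite ler_wpM2l // lerXn2r ?nnegrE // ltW.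
move=> /(lerD (lexx (`|z| * (d * r ^+ k)))) /le_trans; apply.
have -> : `|z| * (d * r ^+ k) + c * r ^+ k = (`|z| * d + c) * r ^+ k by ring.
rewrite exprS mulrA; apply: ler_wpM2r; first by rewrite exprn_ge0 // ltW.
rewrite -lerBrDl; have -> : d * r - `|z| * d = (r - `|z|) * d by ring.
have rz0 : 0 < r - `|z| by rewrite subr_gt0.
rewrite /d mulrDr [X in _ + X]mulrC divfK ?gt_eqF // lerDr mulr_ge0 ?(ltW rz0) //.
by apply: sumr_ge0 => l _; exact: sumr_ge0.
Qed.

End Spectrum.

(** * Deflating the eigenvalue 1 *)

Lemma count_mem_iter_rem (T : eqType) (x y : T) (m : nat) (s : seq T) :
  count_mem y (iter m (rem x) s) = (count_mem y s - (x == y) * m)%N.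
Proof.
elim: m => [|m IH] /=; first by rewrite muln0 subn0.
by rewrite count_mem_rem IH mulnS -subnDA addnC.
Qed.

Section Deflation.
Variables (R : realType) (n m : nat).
Variables (A : 'M[R]_n.+1) (B : 'M[R]_(m, n.+1)) (B' : 'M[R]_(n.+1, m)).
Hypotheses (BB' : B *m B' = 1%:M) (BA : B *m A = B).

Let K := A - A *m B' *m B.
Let toC k l (M : 'M[R]_(k, l)) := map_mx (real_complex R) M.

Lemma char_poly_eigenvalues (M : 'M[R]_n.+1) :
  char_poly (toC M) = \prod_(z <- eigenvalues M) ('X - z%:P).
Proof.
rewrite /eigenvalues /toC; case: closed_field_poly_normal => /= s {1}->.
by rewrite (monicP (char_poly_monic _)) scale1r.
Qed.

(** Comparing roots in [char_poly_deflate], the eigenvalues of [A] together with m zeros are those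
    of [K] together with m ones. So a nonzero eigenvalue of [K] survives the removal of m ones from
    those of [A]. *)
Lemma eigenvalue_deflate_norm_lt1 :
  (forall z, z \in iter m (rem (1 : R[i])) (eigenvalues A) -> `|z| < 1) ->
  all (fun z => `|z| < 1) (eigenvalues K).
Proof.
move=> hA; apply/allP => z zK.
have [->|z0] := eqVneq z 0; first by rewrite normr0.
apply: hA; rewrite -has_pred1 has_count count_mem_iter_rem.
have -> : count_mem z (eigenvalues A) =
    ((1%R == z) * m + count_mem z (eigenvalues K))%N.
  have /(@prod_XsubC_eq _ (nseq m 0 ++ _) (nseq m 1 ++ _)) /permP /(_ (pred1 z)) :
      \prod_(x <- nseq m 0 ++ eigenvalues A) ('X - x%:P) =
      \prod_(x <- nseq m 1 ++ eigenvalues K) ('X - x%:P).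
    rewrite !big_cat /= -!char_poly_eigenvalues !big_nseq.
    rewrite !iter_mulr !mulr1 subr0.
    have -> : toC K = toC A - toC A *m toC B' *m toC B.
      by rewrite /toC /K map_mxB !map_mxM.
    by apply: char_poly_deflate; rewrite /toC -map_mxM ?BB' ?BA ?map_mx1.
  rewrite !count_cat !count_nseq /= eq_sym (negPf z0) mul0n add0n.
  by move=> ->.
by rewrite addKn -has_count has_pred1.
Qed.

(** By Cayley-Hamilton the product of the factors X - z over the eigenvalues of [K] annihilates [K],
    so [geometric_decay] applies over the complex numbers. *)
Lemma deflate_power_decay :
  (forall z, z \in iter m (rem (1 : R[i])) (eigenvalues A) -> `|z| < 1) ->
  exists c q : R, [/\ 0 <= c, 0 < q < 1 &
    forall k i j, `|(K ^+ k) i j| <= c * q ^+ k].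
Proof.
move=> /eigenvalue_deflate_norm_lt1 hK.
have [|c [q [c0 /andP[q0 q1] hcq]]] :=
    @geometric_decay _ n n.+1 (toC K) _ 1%:M hK.
  by rewrite -char_poly_eigenvalues Cayley_Hamilton mul0mx.
(* A nonnegative element of [R[i]] is real in the partial order used there, so both constants
   descend to [R]. *)
have realE (z : R[i]) : 0 <= z -> z = (complex.Re z)%:C%C.
  by move=> /ger0_Im z0; case: z z0 => a b /= ->.
have [cE qE] := (realE c c0, realE q (ltW q0)).
exists (complex.Re c), (complex.Re q); split.
- by rewrite -(@lecR R) -cE.
- by rewrite -!(@ltcR R) -qE q0.
move=> k i j; rewrite -(@lecR R) rmorphM rmorphXn /= -cE -qE.
apply: le_trans (hcq k i j).
have -> : toC K ^+ k = toC (K ^+ k) by rewrite /toC rmorphXn.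
rewrite mulmx1 mxE.
by rewrite normc_def /= expr0n addr0 sqrtr_sqr.
Qed.

End Deflation.

(** * Norms on matrix spaces *)

Section MatrixNorm.
Variable R : realType.

Lemma ler_mx_entry m n (x : 'M[R]_(m, n)) i j : `|x i j| <= `|x|.
Proof.
by rewrite {2}/Num.Def.normr /= mx_normrE; exact: (le_bigmax _ _ (i, j)).
Qed.

Lemma ler_mx_norm m n (x : 'M[R]_(m, n)) (c : R) :
  0 <= c -> (forall i j, `|x i j| <= c) -> `|x| <= c.
Proof.
move=> c0 hx; rewrite /Num.Def.normr /= mx_normrE.
by apply/bigmax_leP; split=> // -[i j] _ /=.
Qed.

Lemma ler_norm_mulmx m n p (x : 'M[R]_(m, n)) (y : 'M[R]_(n, p)) :
  `|x *m y| <= n%:R * `|x| * `|y|.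
Proof.
apply: ler_mx_norm => [|i j]; first by rewrite !mulr_ge0.
rewrite mxE (le_trans (ler_norm_sum _ _ _)) //.
have -> : n%:R * `|x| * `|y| = \sum_(k < n) `|x| * `|y|.
  by rewrite sumr_const card_ord -mulrA mulr_natl.
by apply: ler_sum => k _; rewrite normrM ler_pM // ler_mx_entry.
Qed.

Lemma linear_mx_bounded m n (W : normedModType R) (f : {linear 'M[R]_(m, n) -> W}) :
  exists2 c, 0 <= c & forall x, `|f x| <= c * `|x|.
Proof.
exists (\sum_i \sum_j `|f (delta_mx i j)|).
  by apply: sumr_ge0 => i _; exact: sumr_ge0.
move=> x; rewrite {1}(matrix_sum_delta x) linear_sum mulr_suml.
rewrite (le_trans (ler_norm_sum _ _ _)) //; apply: ler_sum => i _.
rewrite linear_sum mulr_suml (le_trans (ler_norm_sum _ _ _)) //.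
by apply: ler_sum => j _; rewrite linearZ normrZ mulrC ler_wpM2l // ler_mx_entry.
Qed.

Lemma linear_mx_continuous m n (W : normedModType R)
  (f : {linear 'M[R]_(m, n) -> W}) : continuous f.
Proof.
apply/linear_bounded_continuous; have [c c0 hc] := linear_mx_bounded f.
apply/linear_boundedP; exists c; split; first exact: ger0_real.
by move=> d cd x; apply: le_trans (hc x) _; rewrite ler_wpM2r // ltW.
Qed.

(** With e = d / (1 - q), the intervals of radius e q^k about [u k] are nested, because e q^k - e
    q^(k+1) = d q^k. The supremum of their left endpoints lies in all of them. *)
Lemma geometric_step_cvg (u : nat -> R) (d q : R) :
  0 <= d -> 0 < q < 1 -> (forall k, `|u k.+1 - u k| <= d * q ^+ k) ->
  exists l, forall k, `|u k - l| <= d / (1 - q) * q ^+ k.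
Proof.
move=> d0 /andP[q0 q1] hu; set e := d / (1 - q).
have e0 : 0 <= e by rewrite divr_ge0 // subr_ge0 ltW.
have eE k : e * q ^+ k - e * q ^+ k.+1 = d * q ^+ k.
  have -> : d = e * (1 - q) by rewrite divfK // gt_eqF // subr_gt0.
  by rewrite exprS; ring.
clearbody e.
have lo k j : u k - e * q ^+ k <= u (k + j)%N - e * q ^+ (k + j).
  elim: j => [|j IH]; first by rewrite addn0.
  apply: le_trans IH _; rewrite addnS.
  by have := hu (k + j)%N; have := eE (k + j)%N; rewrite ler_norml; lra.
have hi k j : u (k + j)%N + e * q ^+ (k + j) <= u k + e * q ^+ k.
  elim: j => [|j IH]; first by rewrite addn0.
  apply: le_trans _ IH; rewrite addnS.
  by have := hu (k + j)%N; have := eE (k + j)%N; rewrite ler_norml; lra.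
have lohi j k : u j - e * q ^+ j <= u k + e * q ^+ k.
  apply: le_trans (lo j k) _; rewrite addnC; apply: le_trans _ (hi k j).
  by rewrite lerD2l (@le_trans _ _ 0) ?oppr_le0 ?mulr_ge0 ?exprn_ge0 // ltW.
exists (sup (range (fun j => u j - e * q ^+ j))) => k.
rewrite ler_norml lerBrDr lerBlDr; apply/andP; split.
  rewrite addrC lerBlDr; apply: ge_sup; first by exists (u 0%N - e * q ^+ 0), 0%N.
  by move=> _ [j _ <-]; exact: lohi.
rewrite -lerBlDl; apply: ub_le_sup; last by exists k.
by exists (u 0%N + e * q ^+ 0) => _ [j _ <-]; exact: lohi.
Qed.

Lemma geometric_step_cvg_mx m n (u : nat -> 'M[R]_(m, n)) (d q : R) :
  0 <= d -> 0 < q < 1 -> (forall k, `|u k.+1 - u k| <= d * q ^+ k) ->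
  exists l, forall k, `|u k - l| <= d / (1 - q) * q ^+ k.
Proof.
move=> d0 q01 hu.
have huij i j : exists l, forall k, `|u k i j - l| <= d / (1 - q) * q ^+ k.
  apply: geometric_step_cvg => // k; apply: le_trans (hu k).
  by have := ler_mx_entry (u k.+1 - u k) i j; rewrite !mxE.
have [l hl] := choice (fun ij => huij ij.1 ij.2).
exists (\matrix_(i, j) l (i, j)) => k; apply: ler_mx_norm => [|i j].
  case/andP: q01 => q0 q1.
  by rewrite mulr_ge0 ?divr_ge0 ?exprn_ge0 ?subr_ge0 // ltW.
by rewrite !mxE; exact: (hl (i, j)).
Qed.

End MatrixNorm.

(** Choose q < r < 1 and m with c (q / r)^(m+1) <= 1, and sum r^-k |K^k x| over k <= m. Replacing x
    by K x shifts the terms at the cost of a factor r, and the new term r^-m |K^(m+1) x| is at most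
    r |x|, the share of the term that drops out. *)
Lemma adapted_norm (R : realType) (V : normedModType R) (K : {linear V -> V})
    (c q : R) :
  0 <= c -> 0 < q < 1 ->
  (forall k x, `|iter k K x| <= c * q ^+ k * `|x|) ->
  exists (Nm : V -> R) (C r : R), [/\ 0 <= C, 0 < r < 1,
    forall x, `|x| <= Nm x <= C * `|x|,
    forall x y, Nm (x + y) <= Nm x + Nm y
    & forall x, Nm (K x) <= r * Nm x].
Proof.
move=> c0 /andP[q0 q1] hK; pose r : R := (1 + q) / 2.
have [r0 r1 qr] : [/\ 0 < r, r < 1 & q < r] by rewrite /r; split; lra.
clearbody r.
have rV0 k : 0 <= r ^- k by rewrite invr_ge0 exprn_ge0 // ltW.
have qr0 : 0 <= q / r by rewrite divr_ge0 // ltW.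
have [m hm] : exists m, c * (q / r) ^+ m.+1 <= 1.
  have qr1 : `|q / r| < 1 by rewrite ger0_norm // ltr_pdivrMr // mul1r.
  have /cvgrPdist_le /(_ 1 ltr01) [m _ hm] := @cvg_geometric R c _ qr1.
  exists m; have := hm m.+1 (leqnSn m).
  by rewrite /= sub0r normrN /geometric /= ger0_norm // mulr_ge0 // exprn_ge0.
pose Nm x := \sum_(k < m.+1) r ^- k * `|iter k K x|.
exists Nm, (\sum_(k < m.+1) r ^- k * (c * q ^+ k)), r; split.
- apply: sumr_ge0 => k _.
  by rewrite mulr_ge0 // mulr_ge0 // exprn_ge0 // ltW.
- by rewrite r0.
- move=> x; apply/andP; split.
    rewrite /Nm big_ord_recl expr0 invr1 mul1r lerDl.
    by apply: sumr_ge0 => k _; rewrite mulr_ge0.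
  rewrite mulr_suml; apply: ler_sum => k _.
  by rewrite -mulrA ler_wpM2l.
- have iterD k x y : iter k K (x + y) = iter k K x + iter k K y.
    by elim: k => //= k ->; rewrite linearD.
  move=> x y; rewrite -big_split; apply: ler_sum => k _ /=.
  by rewrite iterD -mulrDr ler_wpM2l // ler_normD.
move=> x; rewrite /Nm mulr_sumr big_ord_recr /= [leRHS]big_ord_recl /=.
rewrite addrC expr0 invr1 mul1r; apply: lerD; last first.
  apply: ler_sum => k _; rewrite -iterS iterSr /bump /= add1n mulrA exprS invfM.
  by rewrite mulrA divff ?gt_eqF // mul1r -iterSr.
rewrite -iterSr iterS -iterS ler_pdivrMl ?exprn_gt0 //.
apply: le_trans (hK _ _) _; rewrite mulrA -exprSr ler_wpM2r //.
by move: hm; rewrite expr_div_n mulrA ler_pdivrMr ?exprn_gt0 // mul1r.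
Qed.

(** * The similarity action and its slice *)

Section Conformal.
Variable R : realType.

(* Right multiplication by [rot a b] is multiplication by [a + i b] on points
   of the plane written as row vectors. *)
Definition rot (a b : R) : 'M[R]_2 :=
  \matrix_(i, j) if i == j then a else if i == 0 then b else - b.

(** Complex multiplications, zero included, so that [frame] below can be a linear map. *)
Definition conformal (B : 'M[R]_2) : Prop := B = rot (B 0 0) (B 0 1).

Lemma ord2_cases (P : 'I_2 -> Prop) : P 0 -> P 1 -> forall i, P i.
Proof.
move=> h0 h1 [[|[|//]] i2].
- by rewrite (_ : Ordinal i2 = 0) //; exact: val_inj.
- by rewrite (_ : Ordinal i2 = 1) //; exact: val_inj.
Qed.

Lemma lift01 : lift ord0 ord0 = 1 :> 'I_2.
Proof. exact: val_inj. Qed.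

Lemma mulmx_rotE n (v : 'M[R]_(n, 2)) a b i :
  (v *m rot a b) i 0 = v i 0 * a - v i 1 * b /\
  (v *m rot a b) i 1 = v i 0 * b + v i 1 * a.
Proof.
by rewrite !mxE !big_ord_recl !big_ord0 !lift01 !mxE /= !addr0 mulrN.
Qed.

Lemma rot_conformal a b : conformal (rot a b).
Proof. by rewrite /conformal !mxE. Qed.

Lemma rotM a b c d : rot a b *m rot c d = rot (a * c - b * d) (a * d + b * c).
Proof.
apply/matrixP => i; apply: ord2_cases.
- rewrite (mulmx_rotE _ _ _ _).1 !mxE.
  by elim/ord2_cases: i => /=; ring.
rewrite (mulmx_rotE _ _ _ _).2 !mxE.
by elim/ord2_cases: i => /=; ring.
Qed.

Lemma rot10 : rot 1 0 = 1%:M.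
Proof.
by apply/matrixP => i j; rewrite !mxE oppr0; case: eqP => // _; case: ifP.
Qed.

Lemma rot_linear x a b c d : rot (x * a + c) (x * b + d) = x *: rot a b + rot c d.
Proof.
apply/matrixP => i j; rewrite !mxE; case: eqP => // _; case: ifP => // _; ring.
Qed.

Lemma rot00 : rot 0 0 = 0.
Proof.
by apply/matrixP => i j; rewrite !mxE oppr0; case: eqP => // _; case: ifP.
Qed.

Lemma rot_sqr_gt0 a b : rot a b != 0 -> 0 < a ^+ 2 + b ^+ 2.
Proof.
move=> ab0; rewrite lt0r addr_ge0 ?sqr_ge0 // andbT paddr_eq0 ?sqr_ge0 //.
rewrite !sqrf_eq0; apply: contra ab0 => /andP[/eqP -> /eqP ->].
by rewrite rot00.
Qed.

Lemma mulmx_rotV a b : rot a b != 0 ->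
  rot a b *m rot (a / (a ^+ 2 + b ^+ 2)) (- b / (a ^+ 2 + b ^+ 2)) = 1%:M.
Proof.
move=> /rot_sqr_gt0 ab; rewrite rotM -rot10; congr rot; field;
  by rewrite gt_eqF.
Qed.

Lemma conformal_unit B : conformal B -> B != 0 -> B \in unitmx.
Proof. by move=> -> /mulmx_rotV /mulmx1_unit[]. Qed.

Lemma unitmx_neq0 (B : 'M[R]_2) : B \in unitmx -> B != 0.
Proof.
apply: contraTneq => ->; rewrite unitmxE unitfE negbK.
by apply/eqP; exact: (det0 R 1).
Qed.

Lemma invmx_rot a b : rot a b != 0 ->
  invmx (rot a b) = rot (a / (a ^+ 2 + b ^+ 2)) (- b / (a ^+ 2 + b ^+ 2)).
Proof.
move=> ab0; have ab := conformal_unit (rot_conformal a b) ab0.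
by apply: (can_inj (mulKmx ab)); rewrite mulmxV // mulmx_rotV.
Qed.

Lemma conformal_invmx B : conformal B -> B \in unitmx -> conformal (invmx B).
Proof.
by move=> hB /unitmx_neq0; rewrite hB => B0; rewrite invmx_rot //;
  exact: rot_conformal.
Qed.

End Conformal.

Section Slice.
Variables (R : realType) (N : nat) (p : 'M[R]_(N, 2)) (k l : 'I_N).
Hypothesis pkl : row k p != row l p.
Implicit Types (x : 'M[R]_(N, 2)) (B m : 'M[R]_2) (c : 'rV[R]_2).

(** The product [const_mx 1 *m c] has all rows equal to [c]: every point is translated by the same
    vector. *)
Definition sim_act B c x : 'M[R]_(N, 2) := x *m B + const_mx 1 *m c.

Let dp i : R := p k i - p l i.
Let D : R := dp 0 ^+ 2 + dp 1 ^+ 2.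

Let D_neq0 : D != 0.
Proof.
apply: contra pkl; rewrite paddr_eq0 ?sqr_ge0 // !sqrf_eq0 /dp !subr_eq0.
move=> /andP[/eqP h0 /eqP h1]; apply/eqP/rowP => i; rewrite !mxE.
by elim/ord2_cases: i.
Qed.

(* The complex number [frame_re x + i frame_im x] is
   [(x_k - x_l) / (p_k - p_l)]. *)
Definition frame_re x : R :=
  ((x k 0 - x l 0) * dp 0 + (x k 1 - x l 1) * dp 1) / D.
Definition frame_im x : R :=
  ((x k 1 - x l 1) * dp 0 - (x k 0 - x l 0) * dp 1) / D.
Definition frame x : 'M[R]_2 := rot (frame_re x) (frame_im x).
(** The translation for which the similarity with linear part [frame x] carries p_l to x_l; by the
    choice of [frame] it then carries p_k to x_k. *)
Definition origin x : 'rV[R]_2 := row l x - row l p *m frame x.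

(* Coordinates of the configuration in the orbit directions which agrees with
   [x] at the indices [k] and [l]. *)
Definition orbit_coord x : 'M[R]_2 :=
  \matrix_(i, j) if i == 0 then (if j == 0 then frame_re x else frame_im x)
                 else origin x 0 j.
(** The first row of [m] is the complex multiplier and the second the translation, so the range is
    the four-dimensional tangent space T of the orbit. *)
Definition orbit_param m : 'M[R]_(N, 2) :=
  sim_act (rot (m 0 0) (m 0 1)) (row 1 m) p.
(** The linear projection along T onto the configurations that vanish at [k] and [l]. Dividing it by
    the frame gives the nonlinear invariant [slice]. *)
Definition slice_proj x : 'M[R]_(N, 2) := x - sim_act (frame x) (origin x) p.
Definition slice x : 'M[R]_(N, 2) := slice_proj x *m invmx (frame x).

Fact frame_is_linear : linear frame.
Proof.
move=> a x y; rewrite /frame -rot_linear /frame_re /frame_im !mxE.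
by congr rot; rewrite mulrA -mulrDl; congr (_ / _); ring.
Qed.
HB.instance Definition _ := GRing.isLinear.Build R _ _ _ frame frame_is_linear.

Fact origin_is_linear : linear origin.
Proof.
move=> a x y; rewrite /origin linearP [frame _]linearP /= mulmxDr -scalemxAr.
by rewrite scalerBr opprD addrACA.
Qed.
HB.instance Definition _ := GRing.isLinear.Build R _ _ _ origin origin_is_linear.

Fact orbit_coord_is_linear : linear orbit_coord.
Proof.
move=> a x y; apply/matrixP => i j; rewrite mxE linearP /= !mxE.
have hf := frame_is_linear a x y.
have /matrixP /(_ 0 0) := hf; rewrite !mxE /= => ->.
by have /matrixP /(_ 0 1) := hf; rewrite !mxE /= => ->;
  case: ifP => // _; case: ifP.
Qed.
HB.instance Definition _ :=
  GRing.isLinear.Build R _ _ _ orbit_coord orbit_coord_is_linear.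

Fact orbit_param_is_linear : linear orbit_param.
Proof.
move=> a m m'; have e i j : (a *: m + m') i j = a * m i j + m' i j by rewrite !mxE.
rewrite /orbit_param /sim_act !e rot_linear.
by rewrite [row _ _]linearP /= !mulmxDr -!scalemxAr scalerDr addrACA.
Qed.
HB.instance Definition _ :=
  GRing.isLinear.Build R _ _ _ orbit_param orbit_param_is_linear.

Lemma orbit_paramE x :
  orbit_param (orbit_coord x) = sim_act (frame x) (origin x) p.
Proof.
rewrite /orbit_param; congr sim_act; first by rewrite !mxE.
by apply/rowP => j; rewrite !mxE.
Qed.

Fact slice_proj_is_linear : linear slice_proj.
Proof.
move=> a x y; rewrite /slice_proj -!orbit_paramE.
rewrite [orbit_coord _]linearP [orbit_param _]linearP /=.
by rewrite scalerBr opprD addrACA.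
Qed.
HB.instance Definition _ :=
  GRing.isLinear.Build R _ _ _ slice_proj slice_proj_is_linear.

Lemma frame_conformal x : conformal (frame x).
Proof. exact: rot_conformal. Qed.

Lemma frame_act B c x : conformal B -> frame (sim_act B c x) = frame x *m B.
Proof.
move=> ->; rewrite /frame rotM; set a := B 0 0; set b := B 0 1.
have [xE0 xE1] :
    (forall i, sim_act (rot a b) c x i 0 = x i 0 * a - x i 1 * b + c 0 0) /\
    (forall i, sim_act (rot a b) c x i 1 = x i 0 * b + x i 1 * a + c 0 1).
  have [e0 e1] := all_and2 (mulmx_rotE x a b).
  by split=> i; rewrite mxE ?e0 ?e1; congr (_ + _); rewrite mxE big_ord1 mxE mul1r.
by rewrite /frame_re /frame_im !xE0 !xE1; congr rot; field.
Qed.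

Lemma row_const_mulmx c i : row i (const_mx 1 *m c : 'M[R]_(N, 2)) = c.
Proof. by apply/rowP => j; rewrite !mxE big_ord1 mxE mul1r. Qed.

Lemma row_sim_act i B c x : row i (sim_act B c x) = row i x *m B + c.
Proof. by rewrite /sim_act linearD /= row_const_mulmx row_mul. Qed.

Lemma origin_act B c x : conformal B -> origin (sim_act B c x) = origin x *m B + c.
Proof.
move=> hB; by rewrite /origin frame_act // row_sim_act mulmxBl mulmxA addrAC.
Qed.

Lemma slice_proj_act B c x :
  conformal B -> slice_proj (sim_act B c x) = slice_proj x *m B.
Proof.
move=> hB; rewrite /slice_proj frame_act // origin_act // /sim_act.
move: (origin x) => o; rewrite mulmxBl mulmxDl mulmxDr !mulmxA addrA.
by rewrite [in LHS]opprD addrACA subrr addr0.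
Qed.

Lemma frame_base : frame p = 1%:M.
Proof.
rewrite -rot10 /frame /frame_re /frame_im -/(dp 0) -/(dp 1).
congr rot; last by rewrite [dp 1 * _]mulrC subrr mul0r.
by rewrite -!expr2 divff.
Qed.

Lemma origin_base : origin p = 0.
Proof. by rewrite /origin frame_base mulmx1 subrr. Qed.

Lemma sim_act_id x : sim_act 1%:M 0 x = x.
Proof. by rewrite /sim_act mulmx1 mulmx0 addr0. Qed.

Lemma slice_proj_base : slice_proj p = 0.
Proof. by rewrite /slice_proj frame_base origin_base sim_act_id subrr. Qed.

Lemma orbit_paramK : cancel orbit_param orbit_coord.
Proof.
move=> m; have c := rot_conformal (m 0 0) (m 0 1).
have fE : frame (orbit_param m) = rot (m 0 0) (m 0 1).
  by rewrite frame_act // frame_base mul1mx.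
have oE : origin (orbit_param m) = row 1 m.
  by rewrite origin_act // origin_base mul0mx add0r.
apply/matrixP => i j; rewrite mxE oE mxE.
have /matrixP /(_ 0 0) := fE; rewrite !mxE /= => ->.
have /matrixP /(_ 0 1) := fE; rewrite !mxE /= => ->.
by elim/ord2_cases: i => /=; elim/ord2_cases: j.
Qed.

Lemma orbit_coordK x : orbit_param (orbit_coord x) = x - slice_proj x.
Proof.
by rewrite orbit_paramE /slice_proj opprB addrC subrK.
Qed.

Lemma frame_slice_proj x : frame (slice_proj x) = 0.
Proof.
rewrite /slice_proj linearB /= frame_act; last exact: frame_conformal.
by rewrite frame_base mul1mx subrr.
Qed.

Lemma origin_slice_proj x : origin (slice_proj x) = 0.
Proof.
rewrite /slice_proj linearB /= origin_act; last exact: frame_conformal.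
by rewrite origin_base mul0mx add0r subrr.
Qed.

Lemma slice_proj_idem x : slice_proj (slice_proj x) = slice_proj x.
Proof.
rewrite {1}/slice_proj frame_slice_proj origin_slice_proj /sim_act.
by rewrite !mulmx0 addr0 subr0.
Qed.

Lemma slice_normal_form x : frame x != 0 ->
  x = sim_act (frame x) (origin x) (p + slice x).
Proof.
move=> x0; rewrite /slice {1}/sim_act mulmxDl mulmxKV; last first.
  by apply: conformal_unit x0; exact: frame_conformal.
by rewrite addrAC -/(sim_act _ _ _) /slice_proj addrC subrK.
Qed.

Lemma sim_act0 B x : sim_act B 0 x = x *m B.
Proof. by rewrite /sim_act mulmx0 addr0. Qed.

Lemma slice_proj_slice x : frame x != 0 -> slice_proj (slice x) = slice x.
Proof.
move=> x0; have ux := conformal_unit (frame_conformal x) x0.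
rewrite /slice -sim_act0 slice_proj_act ?slice_proj_idem ?sim_act0 //.
exact: conformal_invmx (frame_conformal x) ux.
Qed.

(** The action multiplies both [slice_proj x] and [frame x] by [B] on the right, and this factor
    cancels in the quotient. *)
Lemma slice_act B c x : conformal B -> B \in unitmx -> frame x != 0 ->
  slice (sim_act B c x) = slice x.
Proof.
move=> hB uB x0; have ux := conformal_unit (frame_conformal x) x0.
have uxB : frame x *m B \in unitmx by rewrite unitmx_mul ux uB.
rewrite /slice frame_act // slice_proj_act //; apply: (can_inj (mulmxK uxB)).
by rewrite mulmxKV // mulmxA mulmxKV.
Qed.

End Slice.

(** * The linearization on the slice *)

Lemma lin_mx_comp (R : comNzRingType) m1 n1 m2 n2 m3 n3
    (f : {linear 'M[R]_(m1, n1) -> 'M[R]_(m2, n2)})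
    (g : {linear 'M[R]_(m2, n2) -> 'M[R]_(m3, n3)}) :
  lin_mx f *m lin_mx g = lin_mx (g \o f).
Proof.
apply/row_matrixP => i; rewrite !rowE mulmxA.
by rewrite -[delta_mx 0 i]vec_mxK !mul_vec_lin.
Qed.

Lemma eq_lin_mx (R : comNzRingType) m1 n1 m2 n2
    (f g : {linear 'M[R]_(m1, n1) -> 'M[R]_(m2, n2)}) :
  f =1 g -> lin_mx f = lin_mx g.
Proof.
move=> fg; apply/row_matrixP => i; rewrite !rowE.
by rewrite -[delta_mx 0 i]vec_mxK !mul_vec_lin /= fg.
Qed.

(** With [B] and [B'] the matrices of [orbit_param] and [orbit_coord], the deflated matrix is that
    of [slice_proj \o L], since their composite is the identity minus [slice_proj]. Matrices act on
    row vectors, so products read in the order of application. *)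
Lemma slice_linear_decay (R : realType) (N : nat) (p : 'M[R]_(N.+1, 2))
    (k l : 'I_N.+1) (L : {linear 'M[R]_(N.+1, 2) -> 'M[R]_(N.+1, 2)}) :
  row k p != row l p ->
  (forall m, L (orbit_param p m) = orbit_param p m) ->
  (forall z, z \in iter 4 (rem (1 : R[i])) (eigenvalues (lin_mx L)) -> `|z| < 1) ->
  exists c q : R, [/\ 0 <= c, 0 < q < 1 &
    forall j x, `|iter j (slice_proj p k l \o L) x| <= c * q ^+ j * `|x|].
Proof.
move=> pkl Lfix heig.
pose B := lin_mx (orbit_param p); pose B' := lin_mx (orbit_coord p k l).
have BB' : B *m B' = 1%:M.
  rewrite /B /B' lin_mx_comp; apply/row_matrixP => i; rewrite !rowE mulmx1.
  by rewrite -[delta_mx 0 i]vec_mxK mul_vec_lin /= orbit_paramK.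
have BA : B *m lin_mx L = B.
  by rewrite /B lin_mx_comp; apply: eq_lin_mx => m /=; exact: Lfix.
pose K : 'M[R]_(N.+1 * 2) := lin_mx L - lin_mx L *m B' *m B.
(* The dimension [N.+1 * 2] is convertible to [(N * 2).+2], the successor form in which square
   matrices carry powers. *)
pose Kj j : 'M[R]_(N.+1 * 2) := (K : 'M[R]_((N * 2).+2)) ^+ j.
have [c [q [c0 q01 hcq]]] : exists c q : R, [/\ 0 <= c, 0 < q < 1 &
    forall j a b, `|Kj j a b| <= c * q ^+ j].
  exact: (@deflate_power_decay R (N * 2).+1 (2 * 2) (lin_mx L) B B' BB' BA heig).
have KE x : mxvec x *m K = mxvec (slice_proj p k l (L x)).
  rewrite /K mulmxBr !mulmxA !mul_vec_lin /= -linearB /=; congr mxvec.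
  by rewrite orbit_coordK // opprB addrC subrK.
have iterE j x : mxvec (iter j (slice_proj p k l \o L) x) = mxvec x *m Kj j.
  elim: j => [|j IH]; first by rewrite [Kj 0%N]/(1%:M) mulmx1.
  rewrite iterS /= -KE IH -mulmxA; congr (_ *m _).
  by rewrite /Kj [in RHS]exprSr mulmxE.
exists ((N.+1 * 2)%:R * c), q; split=> // [|j x]; first by rewrite mulr_ge0.
apply: ler_mx_norm => [|i i'].
  by case/andP: q01 => q0 _; rewrite !mulr_ge0 // exprn_ge0 // ltW.
rewrite -mxvecE iterE; apply: le_trans (ler_mx_entry _ _ _) _.
apply: le_trans (ler_norm_mulmx _ _) _.
rewrite -!mulrA ler_wpM2l // mulrA [leLHS]mulrC.
apply: ler_pM => //.
  apply: ler_mx_norm => //; rewrite mulr_ge0 ?exprn_ge0 //.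
  by case/andP: q01 => /ltW.
apply: ler_mx_norm => // a b; rewrite (ord1 a).
by case/mxvec_indexP: b => s t; rewrite mxvecE ler_mx_entry.
Qed.

(** * Local contraction towards the orbit *)

Lemma exists_small (R : realType) (M d : R) :
  0 <= M -> 0 < d -> exists2 e, 0 < e & e <= d /\ M * e <= d.
Proof.
move=> M0 d0; have M1 : 0 < M + 1 by lra.
exists (d / (M + 1)); first by rewrite divr_gt0.
split; first by rewrite ler_pdivrMr //; nra.
by rewrite mulrA ler_pdivrMr //; nra.
Qed.

Lemma le0_of_le_geometric (R : realType) (x c q : R) :
  0 < q < 1 -> (forall n, x <= c * q ^+ n) -> x <= 0.
Proof.
move=> /andP[q0 q1] hx; have q1' : `|q| < 1 by rewrite gtr0_norm.
rewrite leNgt; apply/negP => x0.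
have /cvgrPdist_lt /(_ x x0) [m _ hm] := @cvg_geometric R c _ q1'.
have := hm m (leqnn m); rewrite /= sub0r normrN /geometric /= => h.
have := le_lt_trans (hx m) (le_lt_trans (ler_norm _) h).
by rewrite ltxx.
Qed.

Lemma diff_expansion (R : realType) (V W : normedModType R) (F : V -> W)
    (p : V) (e : R) :
  differentiable F p -> 0 < e -> exists2 d, 0 < d &
  forall h, `|h| < d -> `|F (p + h) - F p - 'd F p h| <= e * `|h|.
Proof.
move=> /diff_locally /eqaddoP dF e0.
have /nbhs_ballP[d /= d0 hd] := dF e e0.
exists d => // h hdl; have := hd h; rewrite -ball_normE /= sub0r normrN => /(_ hdl).
by rewrite !fctE /= /cst opprD addrA [h + p]addrC.
Qed.
Section Contraction.
Variables (R : realType) (N : nat) (p : 'M[R]_(N.+1, 2)) (k l : 'I_N.+1).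
Variable F : 'M[R]_(N.+1, 2) -> 'M[R]_(N.+1, 2).
Hypothesis pkl : row k p != row l p.
Hypothesis F_act : forall B c x, conformal B -> B \in unitmx ->
  F (sim_act B c x) = sim_act B c (F x).
Hypothesis F_base : F p = p.
Hypothesis F_diff : differentiable F p.
Hypothesis F_spectrum : forall z : R[i],
  z \in iter 4 (rem (1 : R[i])) (eigenvalues (mesh_jacobian F p)) -> `|z| < 1.

Local Notation frame := (frame p k l).
Local Notation origin := (origin p k l).
Local Notation slice := (slice p k l).
Local Notation slice_proj := (slice_proj p k l).

Lemma fixed_of_slice_proj0 x : frame x != 0 -> slice_proj x = 0 -> F x = x.
Proof.
move=> x0 sx; have ux := conformal_unit (frame_conformal p k l x) x0.
have -> : x = sim_act (frame x) (origin x) p.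
  by apply/eqP; rewrite -subr_eq0 -[X in X == _]/(slice_proj x) sx.
by rewrite F_act ?F_base //; exact: frame_conformal.
Qed.

(** For small t the point p + t v is on the orbit, hence fixed, so the first-order expansion of [F]
    bounds t |v - DF v| by an arbitrarily small multiple of t. *)
Lemma diff_orbit_param m : 'd F p (orbit_param p m) = orbit_param p m.
Proof.
set v := orbit_param p m; apply/esym/eqP; rewrite -subr_eq0 -normr_le0.
apply/ler_addgt0Pr => e e0; rewrite add0r.
have v0 : 0 < `|v| + 1 by rewrite ltr_wpDl.
have e'0 : 0 < e / (`|v| + 1) by rewrite divr_gt0.
have [d d0 hd] := diff_expansion F_diff e'0.
(* The bound d / 2 keeps t v inside the range of the expansion, and 1/2 keeps the frame 1 + t
   [frame v] of p + t v away from 0. *)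
have d'0 : 0 < Num.min (d / 2) 2^-1 by rewrite lt_min; apply/andP; split; lra.
have [|t t0 [_]] := @exists_small R (`|v| + `|frame v|) _ _ d'0.
  by rewrite addr_ge0.
rewrite le_min mulrDl => /andP[h1 h2].
have tv : 0 <= `|v| * t by rewrite mulr_ge0 // ltW.
have tf : 0 <= `|frame v| * t by rewrite mulr_ge0 // ltW.
have ntv : `|t *: v| = `|v| * t by rewrite normrZ gtr0_norm // mulrC.
have Fptv : F (p + t *: v) = p + t *: v.
  apply: fixed_of_slice_proj0; rewrite linearD linearZ /=.
    rewrite frame_base //; apply/eqP => /matrixP /(_ 0 0); rewrite !mxE /= => h.
    have := ler_mx_entry (frame v) 0 0; rewrite mxE /= => h'.
    have : `|t * frame_re p k l v| <= 2^-1.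
      rewrite normrM gtr0_norm // mulrC; apply: le_trans (_ : `|frame v| * t <= _).
        by rewrite ler_wpM2r // ltW.
      by lra.
    by rewrite ler_norml; lra.
  rewrite slice_proj_base // slice_proj_act //; last exact: rot_conformal.
  by rewrite slice_proj_base // mul0mx scaler0 addr0.
have /hd : `|t *: v| < d by rewrite ntv; lra.
rewrite Fptv F_base [p + _]addrC addrK linearZ /= -scalerBr !normrZ gtr0_norm //.
rewrite mulrCA ler_pM2l // => /le_trans; apply.
by rewrite mulrAC ler_pdivrMr // ler_wpM2l ?ltW // ltrDl.
Qed.

(** Near p, projecting F (p + s) to the slice gives K s plus a small remainder, and its frame is 1 +
    O(s), so normalizing by the frame costs little. Equivariance carries the estimate from p +
    [slice x] to x, with displacements scaled by [frame x]. *)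
Lemma slice_contraction :
  exists (Nm : 'M[R]_(N.+1, 2) -> R) (CN C q h : R),
  [/\ 0 <= CN, 0 <= C, 0 < q < 1, 0 < h & 8 * (C * h) <= 1 - q] /\
  [/\ forall x, `|x| <= Nm x <= CN * `|x|,
      forall x y, Nm (x + y) <= Nm x + Nm y
    & forall x, frame x != 0 -> Nm (slice x) < h ->
      [/\ frame (F x) != 0, Nm (slice (F x)) <= q * Nm (slice x),
          `|F x - x| <= C * Nm (slice x) * `|frame x|
        & `|frame (F x) - frame x| <= C * Nm (slice x) * `|frame x| ]].
Proof.
have [c [q0 [c0 q01 hK]]] := slice_linear_decay pkl diff_orbit_param F_spectrum.
have [Nm [CN [r [CN0 /andP[r0 r1] hN ND NK]]]] := adapted_norm c0 q01 hK.
clear c q0 c0 q01 hK.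
have N0 x : 0 <= Nm x by have /andP[+ _] := hN x; apply: le_trans.
have leN x : `|x| <= Nm x by have /andP[] := hN x.
have geN x : Nm x <= CN * `|x| by have /andP[] := hN x.
have [cA cA0 hA] := linear_mx_bounded frame.
have [cS cS0 hS] := linear_mx_bounded slice_proj.
have [cL cL0 hL] := linear_mx_bounded ('d F p).
(* The remainder and the normalization each cost at most g, giving the rate (r + g) / (1 - g), which
   is below 1 because 2 g < 1 - r. *)
pose g := (1 - r) / 4; have g0 : 0 < g by rewrite /g; lra.
have g10 : 0 < Num.min g 1 by rewrite lt_min g0 ltr01.
have [e1 e10 [he1 he1']] := exists_small (mulr_ge0 CN0 cS0) g10.
move: he1' he1; rewrite !le_min => /andP[he _] /andP[_ e11].
have [d d0 hd] := diff_expansion F_diff e10.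
(* Here [a] bounds the change of the frame relative to |s|, and cL + 2 bounds |F (p + s) - (p + s)|;
   the sum [C] serves for both. *)
pose a := cA * (cL + 1); have a0 : 0 <= a by rewrite mulr_ge0 // addr_ge0.
pose C := a + (cL + 2); have C0 : 0 <= C by rewrite addr_ge0 // addr_ge0.
pose q := (r + g) / (1 - g).
have g1 : g < 1 by rewrite /g; lra.
have q0 : 0 < q by rewrite divr_gt0; lra.
have q1 : q < 1 by rewrite ltr_pdivrMr /g; lra.
pose d' := Num.min (Num.min d g) (Num.min 2^-1 (1 - q)).
have d'0 : 0 < d' by rewrite !lt_min d0 g0 subr_gt0 q1 invr_gt0 ltr0n.
(* The three summands of M h make the normalization error at most g, keep the frame of F (p + s)
   nonzero, and yield 8 (2 C) h <= 1 - q. *)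
pose M := 2 * (CN * a) + a + 16 * C.
have CNa : 0 <= CN * a by rewrite mulr_ge0.
have [|h h0 [hd1 hd2]] := @exists_small R M d' _ d'0.
  by rewrite /M; lra.
have ah : 0 <= a * h by rewrite mulr_ge0 // ltW.
have Ch : 0 <= C * h by rewrite mulr_ge0 // ltW.
have CNah : 0 <= CN * a * h by rewrite mulr_ge0 // ltW.
have hM : M * h = 2 * (CN * a * h) + a * h + 16 * (C * h) by rewrite /M; ring.
move: hd1 hd2; rewrite /d' !le_min hM => /andP[/andP[hd1 _] _].
move=> /andP[/andP[_ hg] /andP[h2 hq]].
have base s : slice_proj s = s -> Nm s < h ->
    [/\ frame (F (p + s)) != 0, Nm (slice (F (p + s))) <= q * Nm s,
        `|F (p + s) - (p + s)| <= C * Nm s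
      & `|frame (F (p + s)) - 1%:M| <= a * Nm s].
  move=> sE sh; have sd : `|s| < d by have := leN s; lra.
  set y := F (p + s); set er := y - p - 'd F p s.
  have her : `|er| <= e1 * `|s| by have := hd s sd; rewrite F_base.
  have yE : y = p + ('d F p s + er)
    by rewrite /er [X in p + X]addrC subrK addrC subrK.
  clearbody er.
  have hw : `|'d F p s + er| <= (cL + 1) * `|s|.
    rewrite (le_trans (ler_normD _ _)) // mulrDl lerD //.
    by rewrite (le_trans her) // ler_wpM2r.
  have fy : `|frame y - 1%:M| <= a * `|s|.
    rewrite yE linearD /= frame_base // addrC addKr (le_trans (hA _)) //.
    by rewrite /a -mulrA ler_wpM2l.
  have fyN : `|frame y - 1%:M| <= a * Nm s.
    by rewrite (le_trans fy) // ler_wpM2l.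
  have aNs : a * Nm s <= a * h by rewrite ler_wpM2l // ltW.
  have y0 : frame y != 0.
    apply/eqP => y0; have := le_trans (ler_mx_entry (frame y - 1%:M) 0 0) fyN.
    by rewrite y0 !mxE /= sub0r normrN normr1; lra.
  split=> //.
    have uy := conformal_unit (frame_conformal p k l y) y0.
    set s' := slice y.
    (* Solving [slice_proj y = s' (frame y)] for [s'] perturbatively avoids
       estimating the inverse of [frame y]. *)
    have s'E : s' = slice_proj y + - (s' *m (frame y - 1%:M)).
      by rewrite mulmxBr mulmx1 {2}/s' mulmxKV // opprB addrC subrK.
    have N1 : Nm (slice_proj y) <= r * Nm s + g * Nm s.
      rewrite yE linearD /= slice_proj_base // add0r linearD /=.
      rewrite (le_trans (ND _ _)) // lerD //; first exact: NK.
      rewrite (le_trans (geN _)) // (le_trans (ler_wpM2l _ (hS _))) //.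
      rewrite (le_trans (ler_wpM2l _ (ler_wpM2l _ her))) //.
      by rewrite !mulrA ler_pM // ?mulr_ge0 // ltW.
    have N2 : Nm (- (s' *m (frame y - 1%:M))) <= g * Nm s'.
      rewrite (le_trans (geN _)) // normrN.
      rewrite (le_trans (ler_wpM2l _ (ler_norm_mulmx _ _))) //.
      have : `|s'| * `|frame y - 1%:M| <= Nm s' * (a * h).
        by rewrite ler_pM // (le_trans fyN).
      move=> /(ler_wpM2l (mulr_ge0 CN0 (ler0n _ 2))) hb.
      have -> : CN * (2%:R * `|s'| * `|frame y - 1%:M|) =
          CN * 2 * (`|s'| * `|frame y - 1%:M|) by ring.
      rewrite (le_trans hb) //.
      have -> : CN * 2 * (Nm s' * (a * h)) = 2 * (CN * a * h) * Nm s' by ring.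
      by rewrite ler_wpM2r //; lra.
    have Nle : Nm s' <= r * Nm s + g * Nm s + g * Nm s'.
      by rewrite {1}s'E (le_trans (ND _ _)) // lerD.
    by rewrite /q mulrAC ler_pdivlMr; [nra | lra].
  have -> : y - (p + s) = 'd F p s + er - s.
    by rewrite yE opprD addrA [p + _]addrC addrK.
  rewrite (le_trans (ler_normB _ _)) //.
  rewrite (le_trans (lerD hw (lexx _))) // /C.
  have := leN s; have := normr_ge0 s; nra.
(* The constant doubles because the sup norm of a product with the two-by-two matrix [frame x]
   carries a factor 2. *)
exists Nm, CN, (2 * C), q, h; split; first by split=> //; lra.
split=> // x x0 sh; have ux := conformal_unit (frame_conformal p k l x) x0.
have cx := frame_conformal p k l x.
have [b1 b2 b3 b4] := base _ (slice_proj_slice pkl x0) sh.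
set y := F (p + slice x) in b1 b2 b3 b4.
have FxE : F x = sim_act (frame x) (origin x) y.
  by rewrite {1}(slice_normal_form x0) F_act.
have fFx : frame (F x) = frame y *m frame x by rewrite FxE frame_act.
have uy := conformal_unit (frame_conformal p k l y) b1.
split.
- by rewrite fFx; apply: unitmx_neq0; rewrite unitmx_mul uy ux.
- by rewrite FxE slice_act.
- have -> : F x - x = (y - (p + slice x)) *m frame x.
    rewrite {2}(slice_normal_form x0) FxE /sim_act opprD addrACA subrr.
    by rewrite addr0 mulmxBl.
  by rewrite (le_trans (ler_norm_mulmx _ _)) // ler_wpM2r // -mulrA ler_wpM2l.
have -> : frame (F x) - frame x = (frame y - 1%:M) *m frame x.
  by rewrite mulmxBl mul1mx fFx.
rewrite (le_trans (ler_norm_mulmx _ _)) // ler_wpM2r // -mulrA ler_wpM2l //.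
rewrite (le_trans b4) // ler_wpM2r // /C; lra.
Qed.

End Contraction.

(** * Convergence to the orbit *)

Section Attraction.
Variables (R : realType) (N : nat) (p : 'M[R]_(N.+1, 2)) (k l : 'I_N.+1).
Variable F : 'M[R]_(N.+1, 2) -> 'M[R]_(N.+1, 2).
Hypothesis F_act : forall B c x, conformal B -> B \in unitmx ->
  F (sim_act B c x) = sim_act B c (F x).
Hypothesis F_base : F p = p.

Local Notation frame := (frame p k l).
Local Notation origin := (origin p k l).
Local Notation slice := (slice p k l).
Local Notation slice_proj := (slice_proj p k l).

Variables (Nm : 'M[R]_(N.+1, 2) -> R) (CN C q h : R).
Hypotheses (CN0 : 0 <= CN) (C0 : 0 <= C) (q01 : 0 < q < 1) (h0 : 0 < h).
Hypothesis Ch : 8 * (C * h) <= 1 - q.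
Hypothesis Nm_equiv : forall x, `|x| <= Nm x <= CN * `|x|.
Hypothesis Nm_add : forall x y, Nm (x + y) <= Nm x + Nm y.
Hypothesis F_step : forall x, frame x != 0 -> Nm (slice x) < h ->
  [/\ frame (F x) != 0, Nm (slice (F x)) <= q * Nm (slice x),
      `|F x - x| <= C * Nm (slice x) * `|frame x|
    & `|frame (F x) - frame x| <= C * Nm (slice x) * `|frame x| ].

Let orbit : set 'M[R]_(N.+1, 2) := [set x | frame x != 0 /\ slice_proj x = 0].
Let basin : set 'M[R]_(N.+1, 2) := [set x | frame x != 0 /\ Nm (slice x) < h].

Let q_gt0 : 0 < q. Proof. by case/andP: q01. Qed.
Let q_lt1 : q < 1. Proof. by case/andP: q01. Qed.

Lemma Nm_ge0 x : 0 <= Nm x.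
Proof. by have /andP[+ _] := Nm_equiv x; apply: le_trans. Qed.

Lemma Nm0 : Nm 0 = 0.
Proof.
apply/eqP; rewrite eq_le Nm_ge0 andbT.
by have /andP[_] := Nm_equiv 0; rewrite normr0 mulr0.
Qed.

Lemma slice_eq0 x : frame x != 0 -> (slice x = 0) <-> (slice_proj x = 0).
Proof.
move=> x0; have ux := conformal_unit (frame_conformal p k l x) x0.
rewrite /slice; split=> [s0|->]; last by rewrite mul0mx.
by rewrite -(mulmxKV ux (slice_proj x)) s0 mul0mx.
Qed.

Lemma orbit_sub_basin : orbit `<=` basin.
Proof. by move=> x [x0 /(slice_eq0 x0) sx]; split=> //; rewrite sx Nm0. Qed.

Lemma orbit_fixed x : orbit x -> F x = x.
Proof. by case; exact: fixed_of_slice_proj0. Qed.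

Lemma basin_invariant x : basin x -> basin (F x).
Proof.
move=> [x0 xh]; have [Fx0 Fxh _ _] := F_step x0 xh; split=> //.
by apply: le_lt_trans Fxh (le_lt_trans _ xh); rewrite ler_piMl ?Nm_ge0 // ltW.
Qed.

Lemma basin_iter n x : basin x ->
  basin (iter n F x) /\ Nm (slice (iter n F x)) <= q ^+ n * Nm (slice x).
Proof.
move=> xU; elim: n => [|n [IH1 IH2]]; first by rewrite mul1r.
split; first exact: basin_invariant.
case: IH1 => x0 xh; have [_ /le_trans + _ _] := F_step x0 xh; apply.
by rewrite exprS -mulrA ler_wpM2l // ltW.
Qed.

(** A point in every image has a slice of size at most h q^n for all n, hence slice 0; conversely
    orbit points are their own preimages. *)
Lemma basin_iter_cap : \bigcap_n (iter n F @` basin) = orbit.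
Proof.
apply/seteqP; split=> [x hx|x xO n _]; last first.
  exists x; first exact: orbit_sub_basin.
  by elim: n => //= n ->; exact: orbit_fixed.
have [x' [x0' _] /= xE] := hx 0%N I; rewrite xE in x0'; split=> //.
apply/(slice_eq0 x0')/eqP; rewrite -normr_le0.
apply: (@le0_of_le_geometric R _ h q) => // n.
have [y yU <-] := hx n I; have [_ hy] := basin_iter n yU.
have /andP[+ _] := Nm_equiv (slice (iter n F y)); move=> /le_trans; apply.
apply: le_trans hy _; rewrite mulrC ler_wpM2r ?exprn_ge0 ?ltW //.
by case: yU.
Qed.

(** The steps decay geometrically once the frames of the iterates are bounded. The smallness of C h
    keeps these frames within a quarter of [|frame x|] of [frame x], which also prevents collapse to
    a point in the limit. *)
Lemma basin_cvg x : basin x -> exists2 P, orbit P & forall n,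
  `|iter n F x - P| <= 2 * C / (1 - q) * (Nm (slice x) * `|frame x|) * q ^+ n.
Proof.
move=> xU; set s0 := Nm (slice x); set a0 := `|frame x|.
have s00 : 0 <= s0 := Nm_ge0 _.
have s0h : s0 < h by case: xU.
have a00 : 0 < a0 by rewrite normr_gt0; case: xU.
have Cs : C * s0 <= (1 - q) / 8.
  have : C * s0 <= C * h by rewrite ler_wpM2l // ltW.
  by move: Ch; lra.
pose u n := iter n F x.
have qn n : 0 < q ^+ n by rewrite exprn_gt0.
have qn1 n : q ^+ n <= 1 by rewrite exprn_ile1 // ltW.
have uS n : `|u n.+1 - u n| <= C * s0 * q ^+ n * `|frame (u n)| /\
    `|frame (u n.+1) - frame (u n)| <= C * s0 * q ^+ n * `|frame (u n)|.
  have [[x0 xh] sn] := basin_iter n xU; have [_ _ h1 h2] := F_step x0 xh.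
  have le1 : C * Nm (slice (u n)) * `|frame (u n)| <=
      C * s0 * q ^+ n * `|frame (u n)|.
    by rewrite ler_wpM2r // -mulrA ler_wpM2l // mulrC.
  by split; [exact: le_trans h1 le1 | exact: le_trans h2 le1].
(* The changes of the frame are at most (1 - q) / 8 q^n (2 a0), and these telescope to (1 - q^n) / 4
   a0. *)
have near_a0 n : `|frame (u n) - frame x| <= (1 - q ^+ n) / 4 * a0.
  elim: n => [|n IH]; first by rewrite subrr normr0 subrr !mul0r.
  have an : `|frame (u n)| <= 2 * a0.
    rewrite -(subrK (frame x) (frame (u n))) (le_trans (ler_normD _ _)) //.
    have : (1 - q ^+ n) / 4 * a0 <= a0 by have := qn n; nra.
    by rewrite -/a0; lra.
  have -> : frame (u n.+1) - frame x =
      (frame (u n.+1) - frame (u n)) + (frame (u n) - frame x).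
    by rewrite addrA subrK.
  rewrite (le_trans (ler_normD _ _)) //.
  have [_ h2] := uS n; rewrite (le_trans (lerD h2 IH)) //.
  have : C * s0 * q ^+ n * `|frame (u n)| <= (1 - q) / 8 * q ^+ n * (2 * a0).
    by rewrite ler_pM ?mulr_ge0 ?ler_wpM2r // ltW.
  move=> /(lerD (lexx ((1 - q ^+ n) / 4 * a0))); rewrite addrC => /le_trans; apply.
  by rewrite exprS le_eqVlt; apply/orP; left; apply/eqP; field.
have an n : `|frame (u n)| <= 2 * a0.
  rewrite -(subrK (frame x) (frame (u n))) (le_trans (ler_normD _ _)) //.
  have := near_a0 n.
  have : (1 - q ^+ n) / 4 * a0 <= a0 by have := qn n; nra.
  by rewrite -/a0; lra.
have an' n : a0 / 2 <= `|frame (u n)|.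
  have := ler_normB (frame (u n)) (frame (u n) - frame x).
  rewrite opprB addrC subrK -/a0; have := near_a0 n.
  have : (1 - q ^+ n) / 4 * a0 <= a0 / 2 by have := qn n; nra.
  by lra.
pose d := 2 * C * (s0 * a0).
have d0 : 0 <= d by rewrite /d !mulr_ge0 // ltW.
have [P hP] : exists P, forall n, `|u n - P| <= d / (1 - q) * q ^+ n.
  apply: geometric_step_cvg_mx => // n; have [h1 _] := uS n.
  apply: le_trans h1 _; have -> : d * q ^+ n = C * s0 * q ^+ n * (2 * a0).
    by rewrite /d; ring.
  by rewrite ler_wpM2l // !mulr_ge0 // ltW.
exists P; last first.
  move=> n; apply: le_trans (hP n) _; rewrite /d le_eqVlt; apply/orP; left.
  by apply/eqP; ring.
have [cA cA0 hA] := linear_mx_bounded frame.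
have [cS cS0 hS] := linear_mx_bounded slice_proj.
split.
  (* The frames of the iterates have norm at least a0 / 2 and converge to [frame P]. *)
  apply/eqP => P0.
  suff : a0 / 2 <= 0 by lra.
  apply: (@le0_of_le_geometric R _ (cA * (d / (1 - q))) q) => // n.
  apply: le_trans (an' n) _; have := hA (u n - P).
  rewrite linearB /= P0 subr0 => /le_trans; apply.
  by rewrite -mulrA ler_wpM2l.
apply/eqP; rewrite -normr_le0.
(* The first constant comes from [slice_proj] being slice times frame: its norm is at most 2 (q^n
   s0) (2 a0) along the iterates. The second accounts for the distance to the limit. *)
apply: (@le0_of_le_geometric R _ (4 * s0 * a0 + cS * (d / (1 - q))) q) => // n.
have -> : slice_proj P = slice_proj (u n) - slice_proj (u n - P).
  by rewrite [slice_proj (u n - P)]linearB /= subKr.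
rewrite (le_trans (ler_normB _ _)) // mulrDl lerD //; last first.
  by rewrite (le_trans (hS _)) // -mulrA ler_wpM2l.
have [[x0 _] sn] := basin_iter n xU.
have un := conformal_unit (frame_conformal p k l (u n)) x0.
rewrite -(mulmxKV un (slice_proj (u n))) -/(slice (u n)).
rewrite (le_trans (ler_norm_mulmx _ _)) //.
have -> : 4 * s0 * a0 * q ^+ n = 2 * (q ^+ n * s0) * (2 * a0) by ring.
rewrite ler_pM ?mulr_ge0 // ler_wpM2l //.
by have /andP[/le_trans + _] := Nm_equiv (slice (u n)); apply.
Qed.

(** Subadditivity and the upper comparison with the norm make [Nm] Lipschitz with constant [CN]. *)
Lemma Nm_continuous : continuous Nm.
Proof.
have lip x y : Nm x - Nm y <= CN * `|x - y|.
  rewrite lerBlDl -{1}(subrK y x) addrC (le_trans (Nm_add _ _)) // lerD2l.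
  by have /andP[] := Nm_equiv (x - y).
move=> x; apply/(@cvgrPdist_lt _ _ _ _ (nbhs_filter x)) => e e0.
have CN1 : 0 < CN + 1 by move: CN0; lra.
have d0 : 0 < e / (CN + 1) by rewrite divr_gt0.
have := nbhsx_ballx x _ d0; apply: filterS => y; rewrite -ball_normE /= => xy.
have h1 := lip x y; have h2 := lip y x; rewrite distrC in h2.
apply: (@le_lt_trans _ _ (CN * `|x - y|)).
  by rewrite ler_norml; lra.
rewrite ltr_pdivlMr // in xy; apply: le_lt_trans xy.
by rewrite mulrC ler_wpM2l // lerDl.
Qed.

(** Where the frame is nonzero, its inverse is the conjugate over the squared modulus, so the slice
    is a quotient of polynomial maps with nonvanishing denominator. *)
Lemma slice_continuous x : frame x != 0 -> {for x, continuous slice}.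
Proof.
move=> x0.
pose den y := frame_re p k l y * frame_re p k l y +
  frame_im p k l y * frame_im p k l y.
pose g y := (den y)^-1 *:
   (frame_re p k l y *: slice_proj y -
    frame_im p k l y *: (slice_proj y *m rot 0 1)).
have fcont : continuous frame by exact: linear_mx_continuous.
have gE y : frame y != 0 -> g y = slice y.
  move=> y0; rewrite /g /den -!expr2 /slice invmx_rot //.
  set a := frame_re p k l y; set b := frame_im p k l y.
  rewrite [_ / _]mulrC [- b / _]mulrC -[_ * a]addr0 -[_ * - b]addr0.
  rewrite rot_linear rot00 addr0 -scalemxAr; congr (_ *: _).
  have -> : rot a (- b) = a *: 1%:M - b *: rot 0 1.
    rewrite -rot10; apply/matrixP => i j; rewrite !mxE.
    by case: eqP => _; [ring | case: ifP => _; ring].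
  by rewrite mulmxBr -!scalemxAr mulmx1.
have ijcont i j : continuous (fun y => frame y i j : R).
  move=> y; apply: (@continuous_comp _ _ _ frame (fun M : 'M[R]_2 => M i j : R)).
    exact: fcont.
  exact: coord_continuous.
have recont : continuous (frame_re p k l).
  have -> : frame_re p k l = fun y => frame y 0 0.
    by apply/funext => y; rewrite mxE.
  exact: ijcont.
have imcont : continuous (frame_im p k l).
  have -> : frame_im p k l = fun y => frame y 0 1.
    by apply/funext => y; rewrite mxE.
  exact: ijcont.
have scont : continuous slice_proj by exact: linear_mx_continuous.
have rcont : continuous (fun y => slice_proj y *m rot 0 1).
  have : continuous (mulmxr (rot 0 1) \o slice_proj) by exact: linear_mx_continuous.
  by [].
have c1 : {for x, continuous (fun y => frame_re p k l y *: slice_proj y)}.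
  by apply: continuousZ; [exact: recont | exact: scont].
have c2 : {for x,
    continuous (fun y => frame_im p k l y *: (slice_proj y *m rot 0 1))}.
  by apply: continuousZ; [exact: imcont | exact: rcont].
have c3 : {for x, continuous den}.
  exact: (continuousD (continuousM (recont x) (recont x))
    (continuousM (imcont x) (imcont x))).
have D0 : den x != 0.
  by rewrite /den -!expr2 gt_eqF // rot_sqr_gt0.
have c4 := @continuousV _ _ den x D0 c3.
have c5 := continuousB c1 c2.
have gcont : g y @[y --> x] --> g x by exact: (continuousZ c4 c5).
suff : slice y @[y --> x] --> slice x by [].
have nz : \forall y \near x, frame y != 0 by exact: (cvgr_neq0 _ (fcont x) x0).
have eqn : \forall y \near x, g y = slice y.
  exact: (@filterS _ (nbhs x) (nbhs_filter x) _ _ gE nz).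
by rewrite -(gE _ x0); apply: (cvg_trans (near_eq_cvg eqn) gcont).
Qed.

Lemma basin_nbhs (f : 'M[R]_(N.+1, 2) -> R) (e : R) :
  (forall x, frame x != 0 -> {for x, continuous f}) ->
  open [set x | frame x != 0 /\ f x < e].
Proof.
move=> fcont; rewrite openE => x [x0 fx].
have fc : continuous frame by exact: linear_mx_continuous.
apply: (@filterI _ (nbhs x) (nbhs_filter x)); first exact: (cvgr_neq0 _ (fc x) x0).
exact: cvgr_lt (fcont x x0) _ fx.
Qed.

Lemma Nm_slice_continuous x :
  frame x != 0 -> {for x, continuous (fun y => Nm (slice y))}.
Proof.
move=> x0; apply: continuous_comp; first exact: slice_continuous.
exact: Nm_continuous.
Qed.

Lemma open_basin : open basin.
Proof. by apply: basin_nbhs; exact: Nm_slice_continuous. Qed.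

Lemma orbit_attractor : attractor F orbit.
Proof.
split.
  apply/seteqP; split=> [_ [x xO <-]|x xO]; first by rewrite orbit_fixed.
  by exists x => //; exact: orbit_fixed.
exists basin; split.
- exact: open_basin.
- exact: orbit_sub_basin.
- by move=> _ [x xU <-]; exact: basin_invariant.
- exact: basin_iter_cap.
move=> x xU e e0; have [P PO hP] := basin_cvg xU.
set K := _ * _ in hP.
have nq1 : `|q| < 1 by rewrite gtr0_norm.
have /cvgrPdist_lt /(_ e e0) := @cvg_geometric R K q nq1.
apply: filterS => n hn; exists P => //.
apply: le_lt_trans (hP n) _; apply: le_lt_trans (ler_norm _) _.
by move: hn; rewrite sub0r normrN.
Qed.

(** The constant in [basin_cvg] is proportional to the size of the slice times that of the frame,
    and frames are unbounded along the orbit. Requiring this product to be below 1 still leaves an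
    open neighbourhood of the orbit, where the product is 0. *)
Lemma orbit_uniform_attraction : exists U : set 'M[R]_(N.+1, 2),
  [/\ open U, orbit `<=` U
    & exists K q : R, [/\ 0 < K, 0 < q < 1
      & forall x, U x -> exists2 P, orbit P
          & forall n, `|iter n F x - P| <= K * q ^+ n]].
Proof.
exists (basin `&` [set x | frame x != 0 /\ Nm (slice x) * `|frame x| < 1]); split.
- apply: openI; first exact: open_basin.
  apply: basin_nbhs => x x0; have c1 := Nm_slice_continuous x0.
  have c2 : {for x, continuous (fun y => `|frame y|)}.
    apply: continuous_comp; first exact: linear_mx_continuous.
    exact: norm_continuous.
  exact: (continuousM c1 c2).
- move=> x xO; split; first exact: orbit_sub_basin.
  by case: xO => x0 sx; split=> //; rewrite (slice_eq0 x0).2 // Nm0 mul0r.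
have C1 : 0 <= 2 * C / (1 - q) by rewrite !mulr_ge0 // invr_ge0 subr_ge0 ltW.
exists (2 * C / (1 - q) + 1), q; split=> //; first by lra.
move=> x [xU [_ x1]]; have [P PO hP] := basin_cvg xU; exists P => // n.
apply: le_trans (hP n) _; rewrite ler_wpM2r ?exprn_ge0 ?(ltW q_gt0) //.
by apply: le_trans (ler_wpM2l C1 (ltW x1)) _; lra.
Qed.

End Attraction.

(** * The mesh transformation *)

Section MeshSymmetry.
Variable R : realType.

Lemma det_mx22 (A : 'M[R]_2) : \det A = A 0 0 * A 1 1 - A 0 1 * A 1 0.
Proof.
have lift0 : lift (1 : 'I_2) ord0 = 0 by exact: val_inj.
rewrite (expand_det_row A 0) !big_ord_recl big_ord0 addr0 /cofactor.
rewrite !det_mx11 !mxE !lift01 lift0 /= expr0 expr1 mul1r mulN1r mulrN.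
by congr (A _ _ * A _ _ - A _ _ * A _ _); exact: val_inj.
Qed.

(** For rows (a, b) and (c, d), (a - d)^2 + (b + c)^2 is the sum of the squared row lengths minus
    twice the determinant, that is 1 + 1 - 2 = 0. *)
Lemma orthogonal_conformal (A : 'M[R]_2) :
  A *m A^T = 1%:M -> \det A = 1 -> conformal A^T.
Proof.
move=> AA; rewrite det_mx22 => dA.
have e i j : \sum_m A i m * A j m = (i == j)%:R.
  have /matrixP /(_ i j) := AA; rewrite !mxE => <-.
  by apply: eq_bigr => m _; rewrite !mxE.
have := e 0 0; have := e 1 1; rewrite !big_ord_recl !big_ord0 !lift01 !addr0 /=.
set a := A 0 0 in dA *; set b := A 0 1 in dA *.
set c := A 1 0 in dA *; set d := A 1 1 in dA * => h1 h0.
have s0 : (a - d) ^+ 2 + (b + c) ^+ 2 = 0.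
  have -> : (a - d) ^+ 2 + (b + c) ^+ 2 =
      (a * a + b * b) + (c * c + d * d) - 2 * (a * d - b * c) by ring.
  by rewrite h0 h1 dA; ring.
move/eqP: s0; rewrite paddr_eq0 ?sqr_ge0 // !sqrf_eq0 subr_eq0 addr_eq0.
move=> /andP[/eqP ad /eqP bc].
apply/matrixP => i j; rewrite !mxE.
elim/ord2_cases: i; elim/ord2_cases: j => //=.
Qed.

Lemma sim_orbit_slice (N : nat) (p : 'M[R]_(N, 2)) (k l : 'I_N) :
  row k p != row l p ->
  sim_orbit p = [set x | frame p k l x != 0 /\ slice_proj p k l x = 0].
Proof.
move=> pkl; apply/seteqP; split=> [_ [lam [A [b [lam0 AA dA ->]]]]|x [x0 sx]].
  have -> : \matrix_k0 similarity lam A b (row k0 p) =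
      sim_act (lam *: A^T) (lam *: b) p.
    apply/row_matrixP => i; rewrite rowK row_sim_act.
    by rewrite /similarity scalerDr scalemxAr.
  have cA : conformal (lam *: A^T).
    rewrite /conformal (orthogonal_conformal AA dA); set a := _ 0 0; set c := _ 0 1.
    rewrite -[lam *: _]addr0 -rot00 -rot_linear !addr0.
    by congr rot; rewrite !mxE.
  rewrite /= frame_act // slice_proj_act // frame_base // slice_proj_base //.
  rewrite mul1mx mul0mx; split=> //; apply: unitmx_neq0.
  by rewrite unitmxZ ?unitfE ?gt_eqF // unitmx_tr; case/mulmx1_unit: AA.
have xE : x = sim_act (frame p k l x) (origin p k l x) p.
  by apply/eqP; rewrite -subr_eq0 -[X in X == _]/(slice_proj p k l x) sx.
set a := frame_re p k l x; set b := frame_im p k l x.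
have ab0 : 0 < a ^+ 2 + b ^+ 2 by exact: rot_sqr_gt0.
(* Polar decomposition: [lam] is the modulus of the frame, and dividing by it leaves a rotation. The
   translation is divided too, since [similarity] scales after translating. *)
pose lam := Num.sqrt (a ^+ 2 + b ^+ 2).
have lam0 : 0 < lam by rewrite sqrtr_gt0.
have lamE : lam ^+ 2 = a ^+ 2 + b ^+ 2 by rewrite sqr_sqrtr // ltW.
have lamN : lam != 0 by rewrite gt_eqF.
have trE : (lam^-1 *: (frame p k l x)^T) = rot (a / lam) (- b / lam).
  apply/matrixP => i j; rewrite !mxE.
  by elim/ord2_cases: i; elim/ord2_cases: j => /=; rewrite mulrC ?mulNr ?opprK.
have trE' : (rot (a / lam) (- b / lam))^T = rot (a / lam) (b / lam).
  by rewrite -trE linearZ /= trmxK; apply/matrixP => i j; rewrite !mxE;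
    elim/ord2_cases: i; elim/ord2_cases: j => /=; rewrite mulrC ?mulNr.
exists lam, (lam^-1 *: (frame p k l x)^T), (lam^-1 *: origin p k l x).
have ll : a / lam * (a / lam) + b / lam * (b / lam) = 1.
  have -> : a / lam * (a / lam) + b / lam * (b / lam) =
      (a ^+ 2 + b ^+ 2) / lam ^+ 2.
    by field.
  by rewrite lamE divff // gt_eqF.
split=> //.
- rewrite trE trE' rotM -rot10; congr rot; last by field.
  by rewrite -[RHS]ll; ring.
- rewrite trE det_mx22 !mxE /= -[RHS]ll; ring.
apply/row_matrixP => i; rewrite rowK {1}xE row_sim_act /similarity.
rewrite linearZ /= trmxK -scalemxAr -scalerDr.
by rewrite scalerA divff // scale1r.
Qed.

Lemma enorm_rot (v : 'rV[R]_2) a b :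
  enorm (v *m rot a b) = Num.sqrt (a ^+ 2 + b ^+ 2) * enorm v.
Proof.
rewrite /enorm -sqrtrM ?addr_ge0 ?sqr_ge0 //; congr Num.sqrt.
rewrite !big_ord_recl !big_ord0 !lift01 !addr0.
have [-> ->] := mulmx_rotE v a b ord0.
have -> : ord0 = 0 :> 'I_2 by exact: val_inj.
ring.
Qed.

(** The centroid is affinely equivariant, and the ratios are invariant because [B] scales all
    Euclidean lengths by one nonzero factor. *)
Lemma triangle_transform_act (y : 'I_3 -> 'rV[R]_2) (B : 'M[R]_2) (c : 'rV[R]_2) j :
  conformal B -> B \in unitmx ->
  triangle_transform (fun i => y i *m B + c) j = triangle_transform y j *m B + c.
Proof.
move=> hB uB; set y' := fun i => y i *m B + c.
have cE : centroid y' = centroid y *m B + c.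
  have c3 : c = 3^-1 *: (c + c + c).
    have -> : c + c + c = 3 *: c by rewrite scaler_nat !mulrS addr0 addrA.
    by rewrite scalerA mulVf ?scale1r // pnatr_eq0.
  rewrite /centroid /y' -scalemxAl !mulmxDl [X in _ = _ + X]c3 -scalerDr.
  by congr (_ *: _); rewrite [RHS]addrACA; congr (_ + _); rewrite addrACA.
have dE i : y' i - centroid y' = (y i - centroid y) *m B.
  by rewrite cE /y' opprD addrACA subrr addr0 mulmxBl.
have rE i : Defs.ratio y' i = Defs.ratio y i.
  rewrite /Defs.ratio !dE hB !enorm_rot -mulf_div divff ?mul1r //.
  by rewrite gt_eqF // sqrtr_gt0 rot_sqr_gt0 // -hB unitmx_neq0.
rewrite /triangle_transform !dE !rE cE.
move: (y j - centroid y) => u; move: (y (j + 1) - centroid y) => v.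
move: (y (j - 1) - centroid y) => w.
by rewrite mulmxDl !mulmxBl -!scalemxAl addrA.
Qed.

(** Translations pass through the average because its weights sum to 1, each symbol lying in some
    triple. *)
Lemma mesh_transform_act (N : nat) (C : {set triple N}) (B : 'M[R]_2)
    (c : 'rV[R]_2) (x : 'M[R]_(N, 2)) :
  every_symbol_used C -> conformal B -> B \in unitmx ->
  mesh_transform C (sim_act B c x) = sim_act B c (mesh_transform C x).
Proof.
move=> hC hB uB; apply/row_matrixP => k.
rewrite rowK row_sim_act rowK -scalemxAl.
have I0 : #|incident C k|%:R != 0 :> R by rewrite pnatr_eq0 cards_eq0.
under eq_bigr => D _.
  have -> : vertices (sim_act B c x) D =
      fun i => vertices x D i *m B + c.
    by apply/funext => i; rewrite /vertices row_sim_act.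
  rewrite triangle_transform_act //; over.
rewrite big_split /= -mulmx_suml scalerDr; congr (_ + _).
by rewrite sumr_const -[c *+ _]scaler_nat scalerA mulVf // scale1r.
Qed.

End MeshSymmetry.

(** * Differentiability at a mesh *)

Section MeshDifferentiability.
Variable R : realType.

Lemma eq_differentiable (V W : normedModType R) (f g : V -> W) p :
  f =1 g -> differentiable f p -> differentiable g p.
Proof. by move=> /funext ->. Qed.

Lemma differentiable_mx (V : normedModType R) m n (f : V -> 'M[R]_(m, n)) p :
  (forall i j, differentiable (fun x => f x i j : R) p) -> differentiable f p.
Proof.
move=> df.
have -> : f = \sum_i \sum_j (fun x => f x i j *: delta_mx i j).
  apply/funext => x; rewrite fct_sumE {1}(matrix_sum_delta (f x)).
  by apply: eq_bigr => i _; rewrite fct_sumE.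
by do 2! (apply: differentiable_sum => ?); exact: differentiableZl.
Qed.

Lemma differentiable_bigsum (V W : normedModType R) (I : finType) (P : {pred I})
    (f : I -> V -> W) p :
  (forall i, P i -> differentiable (f i) p) ->
  differentiable (fun x => \sum_(i | P i) f i x) p.
Proof.
move=> df; rewrite -fct_sumE.
apply: (big_ind (fun g : V -> W => differentiable g p)); last exact: df.
  exact: (differentiable_cst (0 : W) p).
by move=> g h dg dh; exact: differentiableD.
Qed.

Lemma differentiable_sqrt (V : normedModType R) (f : V -> R) p :
  differentiable f p -> 0 < f p -> differentiable (fun x => Num.sqrt (f x)) p.
Proof.
move=> df f0; apply: differentiable_comp => //.
by apply/derivable1_diffP; have [] := is_derive1_sqrt f0.
Qed.

(** A vertex equal to the centroid would be the midpoint of the other two, and the signed area would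
    vanish. *)
Lemma ccw_centroid_neq (y : 'I_3 -> 'rV[R]_2) j :
  ccw_nondegenerate y -> enorm (y j - centroid y) != 0.
Proof.
rewrite /ccw_nondegenerate => area; rewrite gt_eqF // sqrtr_gt0 lt0r.
rewrite sumr_ge0 ?andbT => [|i _]; last exact: sqr_ge0.
apply/eqP => /eqP; rewrite psumr_eq0 => [|i _]; last exact: sqr_ge0.
move=> /allP h; have {}h i : 3 * y j 0 i = y 0 0 i + y 1 0 i + y 2%:R 0 i.
  have := h i (mem_index_enum _); rewrite /= sqrf_eq0 !mxE => /eqP.
  by lra.
have := h 0; have := h 1; move: area; rewrite /signed_area2 !mxE.
have [->|->|->] : [\/ j = 0, j = 1 | j = 2%:R].
  case: j h => [[|[|[|//]]] jlt] _;
    [apply: Or31|apply: Or32|apply: Or33]; exact: val_inj.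
all: set a0 := y 0 0 0; set a1 := y 0 0 1; set b0 := y 1 0 0; set b1 := y 1 0 1.
all: set c0 := y 2%:R 0 0; set c1 := y 2%:R 0 1; move=> area h1 h0.
all: suff : (b0 - a0) * (c1 - a1) - (b1 - a1) * (c0 - a0) = 0.
all: try by move=> area0; rewrite area0 ltxx in area.
- have [-> ->] : c0 = 2 * a0 - b0 /\ c1 = 2 * a1 - b1 by split; lra.
  by ring.
- have [-> ->] : c0 = 2 * b0 - a0 /\ c1 = 2 * b1 - a1 by split; lra.
  by ring.
have [-> ->] : b0 = 2 * c0 - a0 /\ b1 = 2 * c1 - a1 by split; lra.
by ring.
Qed.

(** The formula could only be singular where a distance from vertex to centroid vanishes, through
    the square root or the division, and nondegenerate triangles exclude this. *)
Lemma mesh_transform_differentiable (N : nat) (C : {set triple N})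
    (p : 'M[R]_(N, 2)) :
  (forall D, D \in C -> ccw_nondegenerate (vertices p D)) ->
  differentiable (mesh_transform C) p.
Proof.
move=> hccw; apply: differentiable_mx => k i.
apply: (@eq_differentiable _ R (fun x => #|incident C k|%:R^-1 *
    \sum_(D in incident C k) triangle_transform (vertices x D) (position k D) 0 i)).
  by move=> x; rewrite !mxE summxE.
apply: differentiableM; first exact: differentiable_cst.
apply: differentiable_bigsum => D; rewrite inE => /andP[/hccw area _].
have dy j i' : differentiable (fun x : 'M[R]_(N, 2) => vertices x D j 0 i') p.
  apply: (@eq_differentiable _ R (fun x : 'M[R]_(N, 2) => x (D j) i')).
    by move=> x; rewrite mxE.
  exact: differentiable_coord.
have dc i' :
    differentiable (fun x : 'M[R]_(N, 2) => centroid (vertices x D) 0 i') p.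
  apply: (@eq_differentiable _ R (fun x => 3^-1 *
      (vertices x D 0 0 i' + vertices x D 1 0 i' + vertices x D 2%:R 0 i'))).
    by move=> x; rewrite !mxE.
  apply: differentiableM; first exact: differentiable_cst.
  by do 2! (apply: differentiableD => //).
have dyc j i' : differentiable (fun x : 'M[R]_(N, 2) =>
    (vertices x D j - centroid (vertices x D)) 0 i') p.
  apply: (@eq_differentiable _ R
      (fun x => vertices x D j 0 i' - centroid (vertices x D) 0 i')).
    by move=> x; rewrite [RHS]mxE [X in _ = _ + X]mxE.
  exact: differentiableB.
have dn j : differentiable (fun x : 'M[R]_(N, 2) =>
    enorm (vertices x D j - centroid (vertices x D))) p.
  apply: differentiable_sqrt; last first.
    by rewrite -sqrtr_gt0 lt0r sqrtr_ge0 andbT; exact: ccw_centroid_neq.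
  apply: differentiable_bigsum => i' _; have d := dyc j i'.
  apply: eq_differentiable (differentiableM d d) => x.
  by rewrite expr2.
have dr j : differentiable (fun x : 'M[R]_(N, 2) => Defs.ratio (vertices x D) j) p.
  apply: differentiableM => //; apply: differentiableV => //.
  exact: ccw_centroid_neq.
have drc a j : differentiable (fun x : 'M[R]_(N, 2) =>
    a * Defs.ratio (vertices x D) j *
    (vertices x D j - centroid (vertices x D)) 0 i) p.
  exact: (differentiableM (differentiableM (differentiable_cst (a : R) p) (dr j))
    (dyc j i)).
set j := position k D.
apply: (@eq_differentiable _ R (fun x =>
    2 / 3 * Defs.ratio (vertices x D) j *
      (vertices x D j - centroid (vertices x D)) 0 i
    - 1 / 3 * Defs.ratio (vertices x D) (j + 1) *
      (vertices x D (j + 1) - centroid (vertices x D)) 0 i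
    - 1 / 3 * Defs.ratio (vertices x D) (j - 1) *
      (vertices x D (j - 1) - centroid (vertices x D)) 0 i
    + centroid (vertices x D) 0 i)).
  by move=> x; rewrite /triangle_transform; move: (centroid _) => c; rewrite !mxE.
exact: (differentiableD (differentiableB (differentiableB (drc _ _) (drc _ _))
  (drc _ _)) (dc i)).
Qed.

End MeshDifferentiability.

(** * The empty configuration and the conclusion *)

Lemma attractor_subsingleton (R : realType) (V : normedModType R)
    (F : V -> V) (A : set V) (P : V -> Prop) (p : V) :
  (forall x y : V, x = y) -> A p ->
  attractor F A /\
  exists U : set V, [/\ open U, A `<=` U
    & exists K q : R, [/\ 0 < K, 0 < q < 1
      & forall M : V, P M -> U M -> exists2 p, A p
        & forall n : nat, `|iter n F M - p| <= K * q ^+ n]].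
Proof.
move=> V1 Ap; have AT : A = setT by apply/seteqP; split=> // x _; rewrite (V1 x p).
split; last first.
  exists setT; split=> //; first exact: openT.
  exists 1, 2^-1; split=> //; first by apply/andP; split; lra.
  move=> M _ _; exists p => // n; rewrite (V1 (iter n F M) p) subrr normr0.
  by rewrite mul1r exprn_ge0.
rewrite AT; split.
  by apply/seteqP; split=> // x _; exists x => //; exact: V1.
exists setT; split=> //; first exact: openT.
  by apply/seteqP; split=> // x _ n _; exists x => //; exact: V1.
move=> x _ e e0; apply: nearW => n; exists p => //.
by rewrite (V1 (iter n F x) p) subrr normr0.
Qed.

Theorem corollary1p2 (R : realType) (N : nat) (C : {set triple N})
    (hC : connectivity C) (hCused : every_symbol_used C)
    (MC : 'M[R]_(N, 2)) (hmesh : triangle_mesh C MC)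
    (hfix : mesh_transform C MC = MC)
    (heig : forall z : R[i],
        z \in iter 4 (rem (1 : R[i]))
                (eigenvalues (mesh_jacobian (mesh_transform C) MC)) ->
        `|z| < 1) :
  attractor (mesh_transform C) (sim_orbit MC) /\
  exists U : set 'M[R]_(N, 2),
    [/\ open U, sim_orbit MC `<=` U
      & exists K q : R, [/\ 0 < K, 0 < q < 1
        & forall M : 'M[R]_(N, 2), triangle_mesh C M -> U M ->
            exists2 P, sim_orbit MC P
              & forall n : nat,
                  `|iter n (mesh_transform C) M - P| <= K * q ^+ n]].
Proof.
case: N C hC hCused MC hmesh hfix heig => [|N] C _ hC p [_ hccw _] hfix heig.
  apply: (@attractor_subsingleton _ _ _ _ _ p) => [x y|].
    by rewrite (flatmx0 x) (flatmx0 y).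
  exists 1, 1%:M, 0; split; rewrite ?ltr01 ?trmx1 ?mulmx1 ?det1 //.
  by rewrite [LHS]flatmx0 [RHS]flatmx0.
(* Two vertices of a triangle containing the symbol 0 serve as [k] and [l]: its positive area forces
   them to be distinct. *)
have [D] := set0Pn _ (hC ord0); rewrite inE => /andP[/hccw area _].
have pkl : row (D 0) p != row (D 1) p.
  apply: contraTneq area => e; rewrite /ccw_nondegenerate /signed_area2.
  by rewrite /vertices -e subrr !mxE !mul0r subrr ltxx.
have F_act (B : 'M[R]_2) c x : conformal B -> B \in unitmx ->
    mesh_transform C (sim_act B c x) = sim_act B c (mesh_transform C x).
  exact: mesh_transform_act.
have F_diff := mesh_transform_differentiable hccw.
have [Nm [CN [K [q [h [[CN0 K0 q01 h0 Kh] [N_equiv N_add F_step]]]]]]] :=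
  slice_contraction pkl F_act hfix F_diff heig.
rewrite (sim_orbit_slice pkl); split.
  exact: (orbit_attractor F_act hfix CN0 K0 q01 h0 Kh N_equiv N_add F_step).
have [U [openU sub [K' [q' [K'0 q'01 hU]]]]] :=
  orbit_uniform_attraction CN0 K0 q01 h0 Kh N_equiv N_add F_step.
exists U; split=> //; exists K', q'; split=> // M _ UM; exact: hU.
Qed.
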